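(* Let $C$ be a differential algebra over $\Lambda$ such that $H_i(C)$ is a free $\Lambda$-module for every $i\ge 0$. Then there exist an $A(\infty)$-algebra structure $(H(C),\{X_i\})$, $X_i:\otimes^i H(C)\to H(C)$, $i=1,2,3,\dots$, on the graded module $H(C)$ such that $$X_1=0,\qquad X_2(a_1\otimes a_2)=-\hat a_1\cdot a_2$$ (where $\cdot$ is the product on $H(C)$ induced by that of $C$), and a morphism of $A(\infty)$-algebras $$\{f_i\}:(H(C),\{X_i\})\to (C,\{m_1,m_2,0,0,\dots\})$$ such that $f_1:H(C)\to C$ induces the identity isomorphism in homology. Here $(C,\{m_1,m_2,0,0,\dots\})$ is $C$ regarded as an $A(\infty)$-algebra.
   Context: $\Lambda$ is an arbitrary associative ring with unit; modules and tensor products are over $\Lambda$. Differential modules and algebras are graded by non-negative integers, with differential $\partial$ of degree $-1$. A differential algebra is an associative graded algebra with $\partial(a\cdot b)=\partial a\cdot b+\hat a\cdot\partial b$ (a unit is not required). For homogeneous $a$, $\hat a=(-1)^{\deg a}a$. Tensor products of homomorphisms are taken without extra signs: $(f\otimes g)(x\otimes y)=f(x)\otimes g(y)$; all signs are written explicitly. An $A(\infty)$-algebra $(M,\{m_i\})$ is a graded $\Lambda$-module $M$ with homomorphisms $m_i:\otimes^iM\to M$, $i=1,2,\dots$, such that $m_i((\otimes^iM)_q)\subset M_{q+i-2}$ and, for all $i\ge1$ and $a_1,\dots,a_i\in M$, $$\sum_{k=0}^{i-1}\sum_{j=1}^{i-k}(-1)^k m_{i-j+1}(\hat a_1\otimes\cdots\otimes\hat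 a_k\otimes m_j(a_{k+1}\otimes\cdots\otimes a_{k+j})\otimes a_{k+j+1}\otimes\cdots\otimes a_i)=0 .$$ A morphism of $A(\infty)$-algebras $\{f_i\}:(M,\{m_i\})\to(M',\{m'_i\})$ is a set of homomorphisms $f_i:\otimes^iM\to M'$, $i=1,2,\dots$, with $f_i((\otimes^iM)_q)\subset M'_{q+i-1}$ and, for all $i\ge 1$, $$\sum_{k=0}^{i-1}\sum_{j=1}^{i-k}(-1)^k f_{i-j+1}(\hat a_1\otimes\cdots\otimes\hat a_k\otimes m_j(a_{k+1}\otimes\cdots\otimes a_{k+j})\otimes\cdots\otimes a_i)=\sum_{t=1}^{i}\sum_{S(t,i)}m'_t(f_{k_1}(a_1\otimes\cdots\otimes a_{k_1})\otimes\cdots\otimes f_{k_t}(a_{i-k_t+1}\otimes\cdots\otimes a_i)),$$ where $S(t,i)$ is the set of tuples $(k_1,\dots,k_t)$ of positive integers with $\sum k_p=i$. A differential algebra $(C,\partial,\cdot)$ is regarded as the $A(\infty)$-algebra $(C,\{m_1,m_2,0,0,\dots\})$ with $m_1=\partial$ and $m_2(a_1\otimes a_2)=-\hat a_1\cdot a_2$. $H(C)$ is the homology of $C$ with respect to $\partial$; for the last assertion $H(C)$ is given zero differential.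
   Formalization: Λ is taken to be a commutative ring with unit instead of an arbitrary associative one: over noncommutative Λ the iterated tensor powers of Λ-modules are not Λ-modules, and the claim fails for left modules with multilinear maps and for bimodules free on one side. *)

(* Defs.v *)
From HB Require Import structures.
From mathcomp Require Import all_boot all_order all_algebra.
From mathcomp Require Import boolp classical_sets functions cardinality fsbigop.
From mathcomp Require Import ring_quotient.

Set Implicit Arguments.
Unset Strict Implicit.
Unset Printing Implicit Defensive.

Import GRing.Theory.
Local Open Scope ring_scope.
Local Open Scope quotient_scope.

(* A graded module is a module M given with its decomposition as the direct   *)
(* sum of submodules M_q (q : nat); the decomposition is recorded by the      *)
(* projections of M onto the summands.                                        *)
Record gradedModule (R : comPzRingType) := GradedModule {
  gr_sort :> lmodType R;
  gr_proj : nat -> {linear gr_sort -> gr_sort};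
  gr_proj_proj : forall p q x,
    gr_proj p (gr_proj q x) = if p == q then gr_proj q x else 0;
  gr_proj_sum : forall x, exists n, x = \sum_(q < n) gr_proj q x
}.

(* x \in M_q, where M_q = 0 for q < 0. *)
Definition homog (R : comPzRingType) (M : gradedModule R) (q : int) (x : M) : bool :=
  match q with Posz n => gr_proj M n x == x | Negz _ => x == 0 end.

(* The linear extension of x |-> (-1)^(deg x) x; only finitely many summands  *)
(* are nonzero (see hat_homog).                                               *)
Definition hat (R : comPzRingType) (M : gradedModule R) (x : M) : M :=
  \sum_(q \in [set: nat]) (-1) ^+ q *: gr_proj M q x.

Record diffModule (R : comPzRingType) := DiffModule {
  dm_graded :> gradedModule R;
  diff : {linear dm_graded -> dm_graded};
  diff_homog : forall (q : int) x, homog q x -> homog (q - 1) (diff x);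
  diff_diff : forall x, diff (diff x) = 0
}.

(* No unit is required, and the multiplication need not be commutative. *)
Record diffAlgebra (R : comPzRingType) := DiffAlgebra {
  da_mod :> diffModule R;
  dmul : da_mod -> da_mod -> da_mod;
  dmul_linearl : forall y, linear (dmul ^~ y);
  dmul_linearr : forall x, linear (dmul x);
  dmul_homog : forall (p q : nat) x y,
    homog p x -> homog q y -> homog (p + q)%N (dmul x y);
  dmulA : associative dmul;
  diff_dmul : forall x y,
    diff da_mod (dmul x y) = dmul (diff da_mod x) y + dmul (hat x) (diff da_mod y)
}.

Section GradedTheory.
Variables (R : comPzRingType) (M : gradedModule R).
Implicit Types x y : M.

Lemma gr_proj_bound x n : x = \sum_(q < n) gr_proj M q x ->
  forall q, (n <= q)%N -> gr_proj M q x = 0.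
Proof.
move=> xE q nq; rewrite xE linear_sum big1 //= => i _.
by rewrite gr_proj_proj gtn_eqF // (leq_trans (ltn_ord i)).
Qed.

Lemma gr_proj_homog p q x : homog q%:Z x -> gr_proj M p x = if p == q then x else 0.
Proof.
by move=> /eqP xq; rewrite -{1}xq gr_proj_proj; case: eqP => // _; rewrite xq.
Qed.

Lemma homog_proj q x : homog q%:Z (gr_proj M q x).
Proof. by rewrite /homog gr_proj_proj eqxx. Qed.

Lemma hatE x n : x = \sum_(q < n) gr_proj M q x ->
  hat x = \sum_(q < n) (-1) ^+ q *: gr_proj M q x.
Proof.
move=> xE; rewrite /hat -(fsbig_widen `I_n)//=; first by rewrite -fsbig_ord.
move=> q /= [_ /negP]; rewrite -leqNgt => nq.
by rewrite (gr_proj_bound xE nq) scaler0.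
Qed.

Lemma hat_homog q x : homog q%:Z x -> hat x = (-1) ^+ q *: x.
Proof.
move=> xq; have h (F : nat -> M) : (forall p, p != q -> F p = 0) ->
    \sum_(p < q.+1) F p = F q.
  move=> F0; rewrite big_ord_recr big1 /= ?add0r // => i _.
  by rewrite F0 // ltn_eqF.
have xE : x = \sum_(p < q.+1) gr_proj M p x.
  rewrite (h (fun p => gr_proj M p x)) => [|p /negPf pq].
    by rewrite (gr_proj_homog _ xq) eqxx.
  by rewrite (gr_proj_homog _ xq) pq.
rewrite (hatE xE) (h (fun p => (-1) ^+ p *: gr_proj M p x)) => [|p /negPf pq].
  by rewrite (gr_proj_homog _ xq) eqxx.
by rewrite (gr_proj_homog _ xq) pq scaler0.
Qed.

Lemma hat_is_linear : linear (@hat R M).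
Proof.
move=> c x y; have [n xE] := gr_proj_sum x; have [p yE] := gr_proj_sum y.
have bnd (z : M) k : (forall q, (k <= q)%N -> gr_proj M q z = 0) ->
    hat z = \sum_(q < k) (-1) ^+ q *: gr_proj M q z.
  move=> z0; rewrite /hat -(fsbig_widen `I_k)//=; first by rewrite -fsbig_ord.
  by move=> q /= [_ /negP]; rewrite -leqNgt => /z0 ->; rewrite scaler0.
have x0 q : (maxn n p <= q)%N -> gr_proj M q x = 0.
  by rewrite geq_max => /andP[nq _]; apply: gr_proj_bound xE _ nq.
have y0 q : (maxn n p <= q)%N -> gr_proj M q y = 0.
  by rewrite geq_max => /andP[_ pq]; apply: gr_proj_bound yE _ pq.
rewrite (bnd x _ x0) (bnd y _ y0) (bnd _ (maxn n p)) => [|q /[dup] /x0 qx /y0 qy].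
  rewrite scaler_sumr -big_split; apply: eq_bigr => i _ /=.
  by rewrite linearP scalerDr !scalerA mulrC.
by rewrite linearP qx qy scaler0 addr0.
Qed.
HB.instance Definition _ := GRing.isLinear.Build R M M *:%R (@hat R M) hat_is_linear.

Lemma hatK : involutive (@hat R M).
Proof.
move=> x; have [n xE] := gr_proj_sum x.
have hE p : gr_proj M p (hat x) = (-1) ^+ p *: gr_proj M p x.
  rewrite (hatE xE) linear_sum /=.
  under eq_bigr do rewrite linearZ /= gr_proj_proj.
  have [np|pn] := leqP n p; last first.
    rewrite (bigD1 (Ordinal pn)) //= eqxx big1 ?addr0 // => i /negPf.
    by rewrite -val_eqE /= eq_sym => ->; rewrite scaler0.
  rewrite (gr_proj_bound xE np) scaler0 big1 // => i _.
  by rewrite gtn_eqF ?scaler0 // (leq_trans (ltn_ord i)).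
have hxE : hat x = \sum_(q < n) gr_proj M q (hat x).
  by under eq_bigr do rewrite hE; exact: hatE.
rewrite (hatE hxE) [RHS]xE; apply: eq_bigr => i _.
by rewrite hE scalerA -expr2 sqrr_sign scale1r.
Qed.

End GradedTheory.

Section Homology.
Variables (R : comPzRingType) (D : diffModule R).
Local Notation d := (diff D).

Lemma gr_proj_diff q x : gr_proj D q (d x) = d (gr_proj D q.+1 x).
Proof.
have [n xE] := gr_proj_sum x; have Hd p : homog (p%:Z - 1) (d (gr_proj D p x)).
  exact/diff_homog/homog_proj.
have hp p : gr_proj D q (d (gr_proj D p x)) =
    if p == q.+1 then d (gr_proj D p x) else 0.
  case: p (Hd p) => [|p]; first by move=> /eqP ->; rewrite linear0.
  rewrite -addn1 PoszD addrK => /(gr_proj_homog q) ->.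
  by rewrite addn1 eqSS eq_sym.
rewrite {1}xE !linear_sum /=; under eq_bigr do rewrite hp.
have [nq|qn] := leqP n q.+1; last first.
  by rewrite (bigD1 (Ordinal qn)) //= eqxx big1 ?addr0 // => i /negPf;
     rewrite -val_eqE /= => ->.
rewrite (gr_proj_bound xE nq) linear0 big1 // => i _.
by rewrite ltn_eqF // (leq_trans (ltn_ord i)).
Qed.

Lemma diff_proj0 x : d (gr_proj D 0 x) = 0.
Proof. exact/eqP/(diff_homog (homog_proj 0 x)). Qed.

Lemma hat_diff x : hat (d x) = - d (hat x).
Proof.
have [n xE] := gr_proj_sum x; have xn := gr_proj_bound xE (leqnn n).
have xE1 : x = \sum_(q < n.+1) gr_proj D q x by rewrite big_ord_recr /= -xE xn addr0.
have dxE : d x = \sum_(q < n) gr_proj D q (d x).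
  under eq_bigr do rewrite gr_proj_diff.
  by rewrite {1}xE1 linear_sum /= big_ord_recl diff_proj0 add0r.
rewrite (hatE dxE) (hatE xE1) linear_sum /= big_ord_recl linearZ /= diff_proj0.
rewrite scaler0 add0r -sumrN; apply: eq_bigr => i _.
by rewrite linearZ /= gr_proj_diff exprS mulN1r scaleNr opprK.
Qed.

Definition cycle_pred : {pred D} := fun x => d x == 0.

Lemma cycle_submod_closed : submod_closed cycle_pred.
Proof.
split=> [|a x y]; rewrite -?topredE /= /cycle_pred ?linear0 ?eqxx // -?topredE /= => /eqP dx /eqP dy.
by rewrite linearP dx dy scaler0 addr0.
Qed.
HB.instance Definition _ :=
  GRing.isSubmodClosed.Build R D cycle_pred cycle_submod_closed.

Definition cycles := {x : D | cycle_pred x}.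
HB.instance Definition _ := [isSub of cycles for @sval _ _].
HB.instance Definition _ := [Choice of cycles by <:].
HB.instance Definition _ := [SubChoice_isSubLmodule of cycles by <:].

Lemma diff_cycle (z : cycles) : d (val z) = 0.
Proof. exact/eqP/(valP z). Qed.

Definition boundary_pred : {pred cycles} := fun z => `[< exists y, val z = d y >].

Lemma boundary_submod_closed : submod_closed boundary_pred.
Proof.
split=> [|a x y]; first by apply/asboolP; exists 0; rewrite !linear0.
move=> /asboolP[x' xE] /asboolP[y' yE]; apply/asboolP.
by exists (a *: x' + y'); rewrite !linearP /= xE yE.
Qed.
HB.instance Definition _ :=
  GRing.isZmodClosed.Build cycles boundary_pred (GRing.submod_closedB boundary_submod_closed).

Definition homology_sort := @Quotient.quot cycles boundary_pred.
HB.instance Definition _ := GRing.Zmodule.on homology_sort.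
HB.instance Definition _ := EqQuotient.on homology_sort.

Definition hclass (z : cycles) : homology_sort := \pi_homology_sort z.

Lemma hclass_eq z z' : hclass z = hclass z' <-> exists y, val z - val z' = d y.
Proof.
rewrite /hclass; split=> [/eqP|H].
  rewrite -Quotient.idealrBE => /asboolP[y yE].
  by exists y; rewrite -yE linearB.
by apply/eqP; rewrite -Quotient.idealrBE; apply/asboolP; rewrite linearB.
Qed.

Lemma hclass_repr (u : homology_sort) : hclass (repr u) = u.
Proof. exact: reprK. Qed.

Lemma hclassP (u : homology_sort) : exists z, u = hclass z.
Proof. by exists (repr u); rewrite hclass_repr. Qed.

Lemma hclassB z z' : hclass (z - z') = hclass z - hclass z'.
Proof. exact: (raddfB (\pi_(@Quotient.quot cycles boundary_pred))). Qed.
Lemma hclassD z z' : hclass (z + z') = hclass z + hclass z'.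
Proof. exact: (raddfD (\pi_(@Quotient.quot cycles boundary_pred))). Qed.

Definition hscale (a : R) (u : homology_sort) : homology_sort :=
  hclass (a *: repr u).

Lemma hscale_class a z : hscale a (hclass z) = hclass (a *: z).
Proof.
apply/hclass_eq; have /hclass_eq[y yE] := hclass_repr (hclass z).
by exists (a *: y); rewrite [RHS]linearZ /= -yE scalerBr.
Qed.

Lemma hscaleA a b u : hscale a (hscale b u) = hscale (a * b) u.
Proof. by have [z ->] := hclassP u; rewrite !hscale_class scalerA. Qed.
Lemma hscale1 : left_id 1 hscale.
Proof. by move=> u; have [z ->] := hclassP u; rewrite hscale_class scale1r. Qed.
Lemma hscaleDr : right_distributive hscale +%R.
Proof.
move=> a u v; have [x ->] := hclassP u; have [y ->] := hclassP v.
by rewrite -hclassD !hscale_class scalerDr hclassD.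
Qed.
Lemma hscaleDl u : {morph hscale^~ u : a b / a + b}.
Proof. by move=> a b; have [z ->] := hclassP u; rewrite !hscale_class scalerDl hclassD. Qed.

HB.instance Definition _ := GRing.Zmodule_isLmodule.Build R homology_sort
  hscaleA hscale1 hscaleDr hscaleDl.

Lemma hclass_is_linear : linear hclass.
Proof. by move=> a x y; rewrite hclassD -hscale_class. Qed.
HB.instance Definition _ :=
  GRing.isLinear.Build R cycles homology_sort *:%R hclass hclass_is_linear.

Lemma cycle_proj_subproof q (z : cycles) : cycle_pred (gr_proj D q (val z)).
Proof.
case: q => [|q]; last by rewrite /cycle_pred -gr_proj_diff diff_cycle linear0.
by rewrite /cycle_pred diff_proj0.
Qed.

Definition cycle_proj q (z : cycles) : cycles :=
  exist _ (gr_proj D q (val z)) (cycle_proj_subproof q z).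

Definition hproj q (u : homology_sort) : homology_sort :=
  hclass (cycle_proj q (repr u)).

Lemma hproj_class q z : hproj q (hclass z) = hclass (cycle_proj q z).
Proof.
apply/hclass_eq; have /hclass_eq[y yE] := hclass_repr (hclass z).
by exists (gr_proj D q.+1 y); rewrite -gr_proj_diff -yE linearB.
Qed.

Lemma hproj_is_linear q : linear (hproj q).
Proof.
move=> a u v; have [x ->] := hclassP u; have [y ->] := hclassP v.
rewrite -linearP !hproj_class -linearP; congr hclass.
by apply: val_inj; rewrite /= !linearP.
Qed.
HB.instance Definition _ q := GRing.isLinear.Build R homology_sort homology_sort
  *:%R (hproj q) (hproj_is_linear q).

Lemma hproj_proj p q u : hproj p (hproj q u) = if p == q then hproj q u else 0.
Proof.
have [z ->] := hclassP u; rewrite !hproj_class.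
transitivity (hclass (if p == q then cycle_proj q z else 0)).
  by congr hclass; apply: val_inj; rewrite /= gr_proj_proj; case: ifP.
by case: ifP => // _; rewrite linear0.
Qed.

Lemma hproj_sum u : exists n, u = \sum_(q < n) hproj q u.
Proof.
have [z ->] := hclassP u; have [n zE] := gr_proj_sum (val z); exists n.
under eq_bigr do rewrite hproj_class.
rewrite -linear_sum; congr hclass; apply: val_inj.
by rewrite linear_sum /= -zE.
Qed.

Definition homology : gradedModule R :=
  @GradedModule R homology_sort (fun q => hproj q) hproj_proj hproj_sum.

Lemma homog_homologyP (q : nat) (u : homology) :
  homog q u <-> exists z : cycles, homog q (val z) /\ u = hclass z.
Proof.
split=> [/eqP <- | [z [/eqP zq ->]]].
  by exists (cycle_proj q (repr (u : homology_sort))); split=> //; exact: homog_proj.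
apply/eqP; rewrite /= hproj_class; congr hclass; exact: val_inj.
Qed.

End Homology.

Section HomologyProduct.
Variables (R : comPzRingType) (C : diffAlgebra R).
Implicit Types x y z : C.

Lemma dmulBl x y z : dmul (x - y) z = dmul x z - dmul y z.
Proof. by have := dmul_linearl z (-1) y x; rewrite !scaleN1r ![- _ + _]addrC. Qed.
Lemma dmulBr x y z : dmul x (y - z) = dmul x y - dmul x z.
Proof. by have := dmul_linearr x (-1) z y; rewrite !scaleN1r ![- _ + _]addrC. Qed.
Lemma dmul0l x : dmul 0 x = 0.
Proof. by rewrite -{1}(subrr 0) dmulBl subrr. Qed.
Lemma dmul0r x : dmul x 0 = 0.
Proof. by rewrite -{1}(subrr 0) dmulBr subrr. Qed.

Lemma dmulNl x y : dmul (- x) y = - dmul x y.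
Proof. by rewrite -[- x]add0r dmulBl dmul0l sub0r. Qed.
Lemma dmulNr x y : dmul x (- y) = - dmul x y.
Proof. by rewrite -[- y]add0r dmulBr dmul0r sub0r. Qed.
Lemma hat_dmul x y : hat (dmul x y) = dmul (hat x) (hat y).
Proof.
have dmulDl u v w : dmul (u + v) w = dmul u w + dmul v w :> C.
  by rewrite -[v]opprK dmulBl !dmulNl.
have dmulDr u v w : dmul u (v + w) = dmul u v + dmul u w :> C.
  by rewrite -[w]opprK dmulBr !dmulNr.
have dmulZl c u v : dmul (c *: u) v = c *: dmul u v :> C.
  by have /= := dmul_linearl v c u 0; rewrite dmul0l !addr0.
have dmulZr c u v : dmul u (c *: v) = c *: dmul u v :> C.
  by have /= := dmul_linearr u c v 0; rewrite dmul0r !addr0.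
have suml v := big_morph (fun u => dmul u v) (fun u w => dmulDl u w v) (dmul0l v).
have sumr u := big_morph (dmul u) (dmulDr u) (dmul0r u).
have [n xE] := gr_proj_sum x; have [p yE] := gr_proj_sum y.
rewrite [in RHS](hatE xE) [in RHS](hatE yE) {1}xE {1}yE !suml linear_sum.
apply: eq_bigr => i _ /=; rewrite !sumr linear_sum; apply: eq_bigr => j _ /=.
rewrite (hat_homog (dmul_homog (homog_proj i x) (homog_proj j y))).
by rewrite dmulZl dmulZr scalerA exprD.
Qed.

Lemma cycle_mul_subproof (z z' : cycles C) : cycle_pred (dmul (val z) (val z')).
Proof. by rewrite /cycle_pred diff_dmul !diff_cycle dmul0l dmul0r addr0. Qed.

Definition cycle_mul (z z' : cycles C) : cycles C :=
  exist _ (dmul (val z) (val z')) (cycle_mul_subproof z z').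

(* The product of H(C) induced by that of C (see hmul_class). *)
Definition hmul (u v : homology C) : homology C :=
  hclass (cycle_mul (repr (u : homology_sort C)) (repr (v : homology_sort C))).

Lemma hmul_class (z z' : cycles C) : hmul (hclass z) (hclass z') = hclass (cycle_mul z z').
Proof.
have /hclass_eq[x xE] := hclass_repr (hclass z).
have /hclass_eq[y yE] := hclass_repr (hclass z').
apply/hclass_eq; exists (dmul x (val (repr (hclass z'))) + dmul (hat (val z)) y).
have dh : diff C (hat (val z)) = 0.
  by apply: oppr_inj; rewrite -hat_diff diff_cycle oppr0 (@hat_homog _ _ 0) ?scaler0 //; apply/eqP; rewrite linear0.
rewrite linearD /= !diff_dmul dh !diff_cycle -xE -yE dmul0r dmul0l addr0 add0r.
by rewrite hatK dmulBl dmulBr addrA subrK.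
Qed.

End HomologyProduct.

Section Free.
Variables (R : comPzRingType) (M : lmodType R).

Definition basis_of_submodule (U B : set M) : Prop :=
  [/\ (B `<=` U)%classic,
      forall x, U x -> exists (s : seq M) (c : M -> R),
        (forall b, b \in s -> B b) /\ x = \sum_(b <- s) c b *: b
    & forall (s : seq M) (c : M -> R), uniq s -> (forall b, b \in s -> B b) ->
        \sum_(b <- s) c b *: b = 0 -> forall b, b \in s -> c b = 0].

Definition free_submodule (U : set M) : Prop := exists B, basis_of_submodule U B.

End Free.

(* R is commutative, so tensor powers over R of an R-module are R-modules.    *)
(* The i-th tensor power of M is only used as the source of homomorphisms,    *)
(* and a homomorphism from it to N is given by an i-linear map from M to N.   *)
(* Such a map is represented by a function on sequences whose values matter   *)
(* only on the sequences a = [:: a_1; ...; a_i] of size i; a family           *)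
(* {g_i : i >= 1} is represented by g : nat -> seq M -> N.                    *)
Section MultilinearFamilies.
Variables (R : comPzRingType) (M N : gradedModule R).
Implicit Types (g : nat -> seq M -> N) (m : nat -> seq M -> M).

Definition multilinear (i : nat) (phi : seq M -> N) : Prop :=
  forall (s1 s2 : seq M) (c : R) (x y : M), (size s1 + (size s2).+1 = i)%N ->
    phi (s1 ++ (c *: x + y) :: s2) =
    c *: phi (s1 ++ x :: s2) + phi (s1 ++ y :: s2).

(* phi maps the q-th component of the i-th tensor power, which is spanned by  *)
(* the tensors a_1 (x) ... (x) a_i with deg a_1 + ... + deg a_i = q, into     *)
(* N_(q + e).                                                                 *)
Definition has_degree (i : nat) (e : int) (phi : seq M -> N) : Prop :=
  forall (q : seq nat) (a : seq M), size a = i ->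
    all2 (fun (p : nat) (x : M) => homog p x) q a ->
    homog ((sumn q)%:Z + e) (phi a).

Definition insertion_sum g m (i : nat) (a : seq M) : N :=
  \sum_(0 <= k < i) \sum_(1 <= j < (i - k).+1)
    (-1) ^+ k *: g (i - j + 1)%N
      ([seq hat x | x <- take k a] ++
         m j (take j (drop k a)) :: drop (k + j) a).

(* The inner sum is over the set S(t, i) of t-tuples of positive integers of  *)
(* sum i; reshape cuts a into consecutive blocks of sizes k_1, ..., k_t.      *)
Definition composition_sum (m' : nat -> seq N -> N) g (i : nat) (a : seq M) : N :=
  \sum_(1 <= t < i.+1)
    \sum_(k : t.-tuple 'I_i.+1 | all (fun p : 'I_i.+1 => 0 < p)%N k
                                   && (\sum_(p <- k) p == i)%N)
      m' t [seq g (size b) b | b <- reshape [seq val p | p <- k] a].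

End MultilinearFamilies.

Definition Ainfty_algebra (R : comPzRingType) (M : gradedModule R)
    (m : nat -> seq M -> M) : Prop :=
  forall i, (0 < i)%N ->
    [/\ multilinear i (m i), has_degree i (i%:Z - 2) (m i)
      & forall a : seq M, size a = i -> insertion_sum m m i a = 0].

Definition Ainfty_morphism (R : comPzRingType) (M M' : gradedModule R)
    (m : nat -> seq M -> M) (m' : nat -> seq M' -> M')
    (f : nat -> seq M -> M') : Prop :=
  forall i, (0 < i)%N ->
    [/\ multilinear i (f i), has_degree i (i%:Z - 1) (f i)
      & forall a : seq M, size a = i ->
          insertion_sum f m i a = composition_sum m' f i a].

Definition dga_operations (R : comPzRingType) (C : diffAlgebra R)
    (i : nat) (a : seq C) : C :=
  match i, a with
  | 1%N, [:: x] => diff C x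
  | 2%N, [:: x; y] => - dmul (hat x) y
  | _, _ => 0
  end.
Arguments dga_operations {R} C i a.

Lemma dga_Ainfty (R : comPzRingType) (C : diffAlgebra R) :
  Ainfty_algebra (dga_operations C).
Proof.
have hatD (x y : C) (c : R) : hat (c *: x + y) = c *: hat x + hat y.
  exact: linearP.
move=> i i0; split.
- move=> s1 s2 c x y; case: i i0 => [|[|[|i]]] // _.
  + by case: s1 s2 => [|u s1] [|w s2]; rewrite /= ?addSn ?addnS //= linearP.
  + case: s1 s2 => [|u [|v s1]] [|w [|t s2]]; rewrite /= ?addSn ?addnS //= => _.
      by rewrite hatD dmul_linearl opprD scalerN.
    by rewrite dmul_linearr opprD scalerN.
  + by rewrite scaler0 addr0.
- have hZ p (x : C) (c : R) : homog p%:Z x -> homog p%:Z (c *: x).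
    by move=> /eqP xp; rewrite /homog linearZ /= xp.
  have h0 (p : int) : homog p (0 : C) by case: p => p; rewrite /homog ?linear0.
  move=> q a; case: i i0 => [|[|[|i]]] // _.
  + case: a => [|x [|x' a]] //= _; case: q => [|p [|p' q]] //=; rewrite ?andbF // andbT addn0 => xp.
    by apply: (diff_homog (q := p%:Z)).
  + case: a => [|x [|y [|y' a]]] //= _; case: q => [|p [|p' [|p2 q]]] //=; rewrite ?andbF //.
    move=> /and3P[xp yp _]; rewrite !addn0.
    have hxy : homog (p + p')%N (dmul (hat x) y).
      by apply: dmul_homog => //; rewrite (hat_homog xp); apply: hZ.
    by have := hZ _ _ (-1) hxy; rewrite scaleN1r.
- case: i i0 => [|[|[|[|i]]]] // _ a.
  + case: a => [|x [|x' a]] //= _.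
    by rewrite /insertion_sum /index_iota /= !(big_cons, big_nil) /= expr0 scale1r diff_diff !addr0.
  + case: a => [|x [|y [|y' a]]] //= _.
    rewrite /insertion_sum /index_iota /= !(big_cons, big_nil) /=.
    rewrite expr0 expr1 !scale1r scaleN1r !addr0 linearN /= diff_dmul hatK.
    by rewrite hat_diff dmulNl !opprK opprD addrA subrr add0r addNr.
  + case: a => [|x [|y [|z [|z' a]]]] //= _.
    rewrite /insertion_sum /index_iota /= !(big_cons, big_nil) /=.
    rewrite !linear0 expr0 !scale1r expr1 scaleN1r !addr0 add0r.
    by rewrite [hat (- _)]linearN /= hat_dmul !hatK dmulNl dmulNr !opprK dmulA add0r subrr.
  + move=> _; rewrite /insertion_sum big_nat big1 // => k /andP[_ ki].
    rewrite big_nat big1 // => j /andP[j1 ji].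
    have m0 n : (2 < n)%N -> forall b, dga_operations C n b = 0.
      by move=> n2 b; move: n2; case: n => [|[|[|n]]].
    case: (ltnP 2 j) => j2; last first.
      by rewrite m0 ?scaler0 //; case: j j1 j2 ji => [|[|[|]]] // _ _ _; rewrite addn1 subSS.
    have mz n s1 s2 : dga_operations C n (s1 ++ 0 :: s2) = 0.
      case: n s1 s2 => [|[|[|n]]] [|u [|v s1]] [|w [|t s2]] //=;
        by rewrite ?linear0 ?dmul0l ?dmul0r ?oppr0 //; case: (s1).
    by rewrite (m0 j) // mz scaler0.
Qed.

(* phi, viewed as a chain map from (H(C), 0) to C, induces the identity:      *)
(* phi u is a cycle whose class is u.                                         *)
Definition induces_identity (R : comPzRingType) (C : diffModule R)
    (phi : homology C -> C) : Prop :=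
  forall u : homology C, exists z : cycles C, val z = phi u /\ hclass z = u.

(* Main.v *)
(* Obstruction theory.  Suppose X_j and f_j have been found for j < n, and let *)
(* U(a) be the defect of the n-th morphism relation before X_n and f_n are    *)
(* chosen.  Computing the boundary of U from the lower relations leaves only  *)
(* f_1 applied to the n-th A(infinity) relation of X; since f_1 u represents  *)
(* u, that relation holds and U(a) is a cycle.  Take X_n(a) to be minus its   *)
(* class, so that U(a) + f_1(X_n(a)) bounds, and choose f_n as a primitive,   *)
(* multilinearly: this is where freeness is used.                             *)

Require Import Defs.
From mathcomp Require Import all_boot all_order all_algebra.
From mathcomp Require Import boolp zify.

Set Implicit Arguments.
Unset Strict Implicit.
Unset Printing Implicit Defensive.

Import GRing.Theory.
Local Open Scope ring_scope.

(** A family of i-linear maps is kept as one function on words, so that the relations of all arities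
    become one identity. In the language of the tensor coalgebra, [insertion] with sign -1 and twist
    [hat] is the coderivation given by [X], and the A(infinity) relations say that its square
    vanishes.

    The heart is [diff_defect]: the boundary of the defect of the morphism relation is [F] applied
    to the square of [X], up to terms that contain the defect itself. It combines the coderivation
    property ([insertion_split]), the cancellation of disjoint insertions ([insertion_insertion]),
    the Leibniz rule ([diff_cup]) and associativity ([cup_cup]). If the defect vanishes up to arity
    n, only f_1 of the next relation for X is left; it is a boundary, and f_1 chooses
    representatives, so that relation holds and the next defect is a cycle ([stage_diff_defect]).
    Its class corrects X_{n+1}, and a primitive of what remains corrects f_{n+1} ([stage_succ]).
    Freeness makes the primitive multilinear: bases yield [homogeneous_coordinates], and primitives
    chosen on basis words extend ([multilinear_primitive]). Each correction leaves lower arities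
    alone, so the stages have a limit ([stage_limit]), which [insertion_sumE] and [composition_sumE]
    translate into the indexed sums. *)

Section LinearFun.
Variables (R : comPzRingType) (U V : lmodType R) (f : U -> V).
Hypothesis fL : linear f.

Lemma lin0 : f 0 = 0.
Proof.
by have := fL (-1) 0 0; rewrite scaler0 addr0 scaleN1r => {1}->; rewrite addNr.
Qed.

Lemma linD x y : f (x + y) = f x + f y.
Proof. by have := fL 1 x y; rewrite !scale1r. Qed.

Lemma linZ c x : f (c *: x) = c *: f x.
Proof. by have := fL c x 0; rewrite lin0 !addr0. Qed.

Lemma linN x : f (- x) = - f x.
Proof. by rewrite -scaleN1r linZ scaleN1r. Qed.

Lemma lin_sum I r (P : pred I) (F : I -> U) :
  f (\sum_(i <- r | P i) F i) = \sum_(i <- r | P i) f (F i).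
Proof. exact: (big_morph f linD lin0). Qed.

End LinearFun.

(** * Multilinear maps on words and sums over cuts *)

Section Multilinear.
Variables (R : comPzRingType) (M N : lmodType R).

(* A family (g_i) of i-linear maps is one function g on sequences, g_i being  *)
(* its restriction to the sequences of size i.                                *)
Definition mlin (g : seq M -> N) : Prop := forall p s,
  linear (fun x => g (p ++ x :: s)).

Lemma mlin_cons g x : mlin g -> mlin (fun a => g (x :: a)).
Proof. by move=> gL p s; exact: (gL (x :: p)). Qed.

Lemma mlin_slot0 g p s : mlin g -> g (p ++ 0 :: s) = 0.
Proof. by move=> gL; exact: (lin0 (gL p s)). Qed.

Lemma mlin_head g s : mlin g -> linear (fun x => g (x :: s)).
Proof. by move=> gL; exact: (gL [::]). Qed.

End Multilinear.

Section SplitSum.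
Variables (R : comPzRingType) (M N : lmodType R).
Implicit Types (h : seq M -> seq M -> N) (a r s : seq M).

Definition split_sum h a : N :=
  \sum_(j < (size a).+1) h (take j a) (drop j a).

Lemma split_sum_nil h : split_sum h [::] = h [::] [::].
Proof. by rewrite /split_sum big_ord1. Qed.

Lemma split_sum_cons h x a :
  split_sum h (x :: a) = h [::] (x :: a) + split_sum (fun r => h (x :: r)) a.
Proof. by rewrite /split_sum big_ord_recl. Qed.

Lemma eq_split_sum h h' a : (forall r s, r ++ s = a -> h r s = h' r s) ->
  split_sum h a = split_sum h' a.
Proof. by move=> hh; apply: eq_bigr => j _; apply: hh; rewrite cat_take_drop. Qed.

Lemma split_sumD h h' a :
  split_sum (fun r s => h r s + h' r s) a = split_sum h a + split_sum h' a.
Proof. exact: big_split. Qed.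

Lemma split_sumZ c h a :
  split_sum (fun r s => c *: h r s) a = c *: split_sum h a.
Proof. by rewrite scaler_sumr. Qed.

Lemma split_sum0 a : split_sum (fun _ _ => 0) a = 0.
Proof. exact: big1_eq. Qed.

Lemma split_sum_last h a : (forall r s, r ++ s = a -> (size r < size a)%N -> h r s = 0) ->
  split_sum h a = h a [::].
Proof.
move=> h0; rewrite /split_sum big_ord_recr /= take_size drop_size big1 ?add0r // => j _.
by apply: h0; rewrite ?cat_take_drop // size_take ltn_ord.
Qed.

Lemma mlin_split_sum h :
  (forall r, mlin (h r)) -> (forall s, mlin (h^~ s)) -> mlin (split_sum h).
Proof.
move=> hr hs p; elim: p h hr hs => [|y p IHp] h hr hs s c u v /=; rewrite !split_sum_cons.
  rewrite (hr [::] [::] s c u v) scalerDr addrACA; congr (_ + _).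
  by rewrite -split_sumZ -split_sumD; apply: eq_split_sum => r s' _; exact: (hs s' [::] r).
rewrite (hr [::] (y :: p) s c u v) scalerDr addrACA; congr (_ + _).
by apply: IHp => [r|s']; [exact: hr|exact: (mlin_cons (g := h^~ s'))].
Qed.

End SplitSum.

Lemma split_sum_lin (R : comPzRingType) (M N N' : lmodType R) (f : N -> N')
    (h : seq M -> seq M -> N) a :
  linear f -> f (split_sum h a) = split_sum (fun r s => f (h r s)) a.
Proof. by move=> fL; exact: lin_sum. Qed.

(** Both sides run over the cuts of [a] into three consecutive pieces. *)
Lemma split_sumA (R : comPzRingType) (M N : lmodType R)
    (k : seq M -> seq M -> seq M -> N) a :
  split_sum (fun b s => split_sum (k b) s) a =
  split_sum (fun r t => split_sum (fun b s => k b s t) r) a.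
Proof.
elim: a k => [|x a IHa] k; first by rewrite !split_sum_nil.
rewrite !split_sum_cons IHa split_sum_nil -addrA; congr (_ + _).
by rewrite -split_sumD; apply: eq_split_sum => r t _; rewrite split_sum_cons.
Qed.

(** * Insertions and deconcatenation *)

Section Insertion.
Variables (R : comPzRingType) (M : lmodType R) (c : R) (t : M -> M).
Implicit Types (m : seq M -> M) (a r s : seq M).

(* The sum of c ^+ size p *: g (map t p ++ m b :: s) over the factorizations  *)
(* a = p ++ b ++ s with b nonempty.                                           *)
Fixpoint insertion (N : lmodType R) m (g : seq M -> N) a : N :=
  if a is x :: a' then
    split_sum (fun r s => g (m (x :: r) :: s)) a' +
    c *: insertion m (fun b => g (t x :: b)) a'
  else 0.

Lemma eq_insertion (N : lmodType R) m m' (g g' : seq M -> N) a :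
  (forall p b s, (0 < size b)%N -> p ++ b ++ s = a ->
     g (map t p ++ m b :: s) = g' (map t p ++ m' b :: s)) ->
  insertion m g a = insertion m' g' a.
Proof.
elim: a g g' => [//|x a IHa] g g' gg' /=; congr (_ + _ *: _).
  by apply: eq_split_sum => r s rs; apply: (gg' [::] (x :: r)); rewrite //= rs.
by apply: IHa => p b s b0 pbs; apply: (gg' (x :: p)); rewrite //= pbs.
Qed.

Lemma insertion_add (N : lmodType R) m (g g' : seq M -> N) a :
  insertion m (fun b => g b + g' b) a = insertion m g a + insertion m g' a.
Proof.
elim: a g g' => [|x a IHa] g g' /=; first by rewrite addr0.
by rewrite IHa split_sumD scalerDr addrACA.
Qed.

Lemma insertion_lin (N N' : lmodType R) (f : N -> N') m (g : seq M -> N) a :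
  linear f -> f (insertion m g a) = insertion m (fun b => f (g b)) a.
Proof.
move=> fL; elim: a g => [|x a IHa] g /=; first exact: lin0.
by rewrite linD // linZ // IHa split_sum_lin.
Qed.

Lemma insertionZ (N : lmodType R) e m (g : seq M -> N) a :
  insertion m (fun b => e *: g b) a = e *: insertion m g a.
Proof.
rewrite -(insertion_lin (f := *:%R e)) // => k x y.
by rewrite scalerDr !scalerA mulrC.
Qed.

Lemma insertion0 (N : lmodType R) m a : insertion m (fun=> 0 : N) a = 0.
Proof.
elim: a => [//|x a IHa] /=.
by rewrite split_sum0 IHa scaler0 addr0.
Qed.

Lemma insertion_addm (N : lmodType R) m m' (g : seq M -> N) a : mlin g ->
  insertion (fun b => m b + m' b) g a = insertion m g a + insertion m' g a.
Proof.
elim: a g => [|x a IHa] g gL /=; first by rewrite addr0.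
rewrite IHa; last exact: mlin_cons.
rewrite scalerDr addrACA -split_sumD; congr (_ + _).
by apply: eq_split_sum => r s _; rewrite (linD (mlin_head s gL)).
Qed.

(** A block shorter than [a] produces a zero entry, which kills the multilinear [g]. *)
Lemma insertion_full (N : lmodType R) m (g : seq M -> N) a : mlin g -> (0 < size a)%N ->
  (forall p b s, (0 < size b < size a)%N -> p ++ b ++ s = a -> m b = 0) ->
  insertion m g a = g [:: m a].
Proof.
case: a => [//|x a] gL _ m0 /=.
rewrite split_sum_last => [|r s rs ra]; last first.
  rewrite (m0 [::] (x :: r) s) //= ?rs //.
  exact: (lin0 (mlin_head s gL)).
rewrite -[RHS]addr0; congr (_ + _).
rewrite (@eq_insertion _ m m _ (fun=> 0)) ?insertion0 ?scaler0 // => p b s b0 pbs.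
rewrite (m0 (x :: p) b s) //=; first exact: (mlin_slot0 (t x :: map t p)).
  by rewrite b0 /= -pbs ltnS !size_cat addnCA leq_addr.
by rewrite pbs.
Qed.

Hypothesis tL : linear t.

Lemma mlin_insertion (N : lmodType R) m (g : seq M -> N) :
  mlin m -> mlin g -> mlin (insertion m g).
Proof.
move=> mL + p; elim: p g => [|y p IHp] g gL s e u v /=.
  rewrite scalerDr addrACA; congr (_ + _).
    rewrite -split_sumZ -split_sumD; apply: eq_split_sum => r s' _.
    by rewrite (mlin_head r mL) (mlin_head s' gL).
  rewrite scalerA mulrC -scalerA -scalerDr; congr (_ *: _).
  rewrite -insertionZ -insertion_add; apply: eq_insertion => p b s' _ _.
  by rewrite tL (mlin_head _ gL).
rewrite IHp; last exact: mlin_cons.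
rewrite mlin_split_sum; first last.
- move=> s' q s1 e' u' v'; rewrite -(mlin_head s' gL) /=.
  by have /= -> := mL (y :: q) s1 e' u' v'.
- by move=> r; exact: mlin_cons.
by rewrite !scalerDr addrACA !scalerA mulrC.
Qed.

End Insertion.

(* The insertion operator is a coderivation for deconcatenation. *)
Lemma insertion_split (R : comPzRingType) (M N : lmodType R) c (t : M -> M)
    m (h : seq M -> seq M -> N) a :
  insertion c t m (split_sum h) a =
  split_sum (fun r s => insertion c t m (h^~ s) r +
                        c ^+ size r *: insertion c t m (h (map t r)) s) a.
Proof.
elim: a h => [|x a IHa] h; first by rewrite split_sum_nil /= scaler0 addr0.
rewrite split_sum_cons expr0 scale1r add0r /=.
under eq_split_sum do rewrite split_sum_cons.
rewrite (@eq_insertion _ _ _ _ _ m m _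
  (fun b => h [::] (t x :: b) + split_sum (fun r => h (t x :: r)) b)); last first.
  by move=> p b s _ _; rewrite split_sum_cons.
rewrite insertion_add IHa split_sumD scalerDr addrACA; congr (_ + _).
rewrite split_sumA -split_sumZ -split_sumD; apply: eq_split_sum => r s _.
by rewrite scalerDr scalerA addrA exprS.
Qed.

(* Insertions at disjoint places occur twice, with opposite signs: only the   *)
(* nested ones remain.                                                        *)
Lemma insertion_insertion (R : comPzRingType) (M N : lmodType R) (t : M -> M)
    m (g : seq M -> N) a :
  mlin g -> involutive t ->
  (forall b, t (m b) = (-1) ^+ size b *: m (map t b)) ->
  insertion (-1) t m (insertion (-1) t m g) a =
  insertion 1 id (insertion (-1) t m m) g a.
Proof.
move=> + tK tm; elim: a g => [//|x a IHa] g gL.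
rewrite [RHS]/= [LHS]/= tK scale1r.
rewrite insertion_add insertionZ IHa; last exact: mlin_cons.
rewrite insertion_split !split_sumD split_sumA.
set S2 := split_sum (fun r s => -1 *: _) a.
set S4 := split_sum (fun r s => (-1) ^+ size r *: _) a.
(* [S2] inserts at the head and then further right, [S4] in the opposite order. The sign in [tm] for
   the block [x :: r] makes them equal, and the sign -1 in front of [S4] then cancels them. *)
have -> : S2 = S4.
  apply: eq_split_sum => r s _; rewrite -!insertionZ.
  apply: eq_insertion => p b s' _ _; have gL' := mlin_head (map t p ++ m b :: s') gL.
  by rewrite tm (linZ gL') scalerA exprS mulN1r mulrN mulN1r opprK.
rewrite !scaleN1r opprD opprK addrA; congr (_ + _).
rewrite opprD addrACA subrr addr0 -[X in _ + X]scaleN1r -split_sumZ -split_sumD.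
apply: eq_split_sum => r s _; have gL' := mlin_head s gL.
rewrite (linD gL') scaleN1r -!scaleN1r (linZ gL'); congr (_ + _ *: _).
  exact: esym (split_sum_lin _ _ gL').
exact: esym (insertion_lin _ _ _ _ _ gL').
Qed.

(** * Degrees *)

Lemma sign_abszD (R : pzRingType) (p q : int) :
  (-1) ^+ absz (p + q) = (-1) ^+ (absz p + absz q) :> R.
Proof.
rewrite -[LHS]signr_odd -[RHS]signr_odd; congr (_ ^+ _); congr nat_of_bool.
by lia.
Qed.

Section Homogeneous.
Variables (R : comPzRingType) (M : gradedModule R).
Implicit Types (q : int) (x y : M).

Lemma homog0 q : homog q (0 : M).
Proof. by case: q => q; rewrite /homog ?linear0. Qed.

Lemma homogP q c x y : homog q x -> homog q y -> homog q (c *: x + y).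
Proof.
case: q => q /eqP xq /eqP yq; rewrite /homog; last by rewrite xq yq scaler0 addr0.
by rewrite linearP xq yq.
Qed.

Lemma homogZ q c x : homog q x -> homog q (c *: x).
Proof. by move=> xq; rewrite -[_ *: _]addr0 homogP ?homog0. Qed.

Lemma homogD q x y : homog q x -> homog q y -> homog q (x + y).
Proof. by move=> xq yq; rewrite -[x]scale1r homogP. Qed.

Lemma homogN q x : homog q x -> homog q (- x).
Proof. by rewrite -scaleN1r; exact: homogZ. Qed.

Lemma homog_sum q I r (P : pred I) (F : I -> M) :
  (forall i, P i -> homog q (F i)) -> homog q (\sum_(i <- r | P i) F i).
Proof. by move=> Fq; elim/big_ind: _ => //; [exact: homog0|move=> *; exact: homogD]. Qed.

Lemma hat_homogz q x : homog q x -> hat x = (-1) ^+ absz q *: x.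
Proof. by case: q => q; [exact: hat_homog|move=> /eqP ->; rewrite linear0 scaler0]. Qed.

Lemma homog_hat q x : homog q x -> homog q (hat x).
Proof. by move=> xq; rewrite (hat_homogz xq) homogZ. Qed.

Lemma homog_uniq p q x : homog p x -> homog q x -> p != q -> x = 0.
Proof.
case: p q => p [] q; try by move=> /eqP // ? /eqP.
move=> xp xq /negPf pq; rewrite -[LHS](eqP xp) (gr_proj_homog _ xq).
by case: eqP => // pq'; move: pq; rewrite pq' eqxx.
Qed.

Definition homogs (q : seq int) (a : seq M) : bool := all2 (fun p x => homog p x) q a.

Lemma homogs_cons (q : seq int) x a : homogs q (x :: a) ->
  exists p (q' : seq int), [/\ q = p :: q', homog p x & homogs q' a].
Proof. by case: q => [//|p q] /andP[xp aq]; exists p, q. Qed.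

End Homogeneous.

Section Degree.
Variables (R : comPzRingType) (M N : gradedModule R).
Implicit Types (g : seq M -> N) (e : int).

(* The restriction of g to sequences of size i has degree i + e. *)
Definition mdeg e g : Prop := forall q a, homogs q a ->
  homog (\sum_(p <- q) p + (size a)%:Z + e) (g a).

(** Every entry is a finite sum of homogeneous components, so words of homogeneous entries, on which
    [hat] is only a sign, suffice. *)
Lemma mlin_homogs (L : lmodType R) (g g' : seq M -> L) : mlin g -> mlin g' ->
  (forall q a, homogs q a -> g a = g' a) -> g =1 g'.
Proof.
move=> gL g'L gg' a; elim: a g g' gL g'L gg' => [|x a IHa] g g' gL g'L gg'.
  exact: (gg' [::]).
have [n ->] := gr_proj_sum x.
rewrite (lin_sum (mlin_head a gL)) (lin_sum (mlin_head a g'L)).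
apply: eq_bigr => i _; apply: (IHa (fun a => g (_ :: a)) (fun a => g' (_ :: a)));
  try exact: mlin_cons.
by move=> q b qb; apply: (gg' (i%:Z :: q)); apply/andP; split; first exact: homog_proj.
Qed.

Lemma hat_multilinear e g a : mlin g -> mdeg e g ->
  hat (g a) = (-1) ^+ (size a + absz e) *: g (map (@hat R M) a).
Proof.
move=> gL ge; move: a; apply: mlin_homogs => [p s c x y|p s c x y|q a qa].
- by rewrite gL linearP.
- rewrite !map_cat /= linearP gL scalerDr !size_cat /=; congr (_ + _).
  by rewrite !scalerA mulrC.
rewrite (hat_homogz (ge q a qa)) -addrA sign_abszD exprD sign_abszD -exprD.
have -> : g (map (@hat R M) a) = (-1) ^+ absz (\sum_(p <- q) p) *: g a.
  elim: a q g gL qa {ge} => [|x a IHa] q g gL.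
    by case: q => // _; rewrite big_nil scale1r.
  move=> /homogs_cons[p [q' [-> xp aq]]] /=; rewrite big_cons sign_abszD.
  rewrite (hat_homogz xp) (linZ (mlin_head _ gL)) exprD -scalerA; congr (_ *: _).
  by rewrite (IHa q' (fun a => g (x :: a))) //; exact: mlin_cons.
by rewrite scalerA -exprD addnC.
Qed.

Lemma mdeg_split_sum e (h : seq M -> seq M -> N) :
  (forall q1 q2 r s, homogs q1 r -> homogs q2 s ->
     homog (\sum_(p <- q1) p + (size r)%:Z + (\sum_(p <- q2) p + (size s)%:Z) + e)
       (h r s)) ->
  mdeg e (split_sum h).
Proof.
move=> he q a; elim: a q e h he => [|x a IHa] q e h he.
  case: q => // _; rewrite split_sum_nil.
  by have := he [::] [::] [::] [::] isT isT; rewrite /= big_nil !addr0 !add0r.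
move=> qa; rewrite split_sum_cons homogD //.
  by have := he [::] q [::] (x :: a) isT qa; rewrite big_nil !add0r.
have [p [q' [-> xp aq]]] := homogs_cons qa.
have -> : \sum_(p <- p :: q') p + (size (x :: a))%:Z + e =
          \sum_(p <- q') p + (size a)%:Z + (p + 1 + e).
  by rewrite big_cons /=; lia.
apply: IHa aq => q1 q2 r s qr qs.
have := he (p :: q1) q2 (x :: r) s; rewrite /= xp => /(_ qr qs).
by rewrite big_cons; congr homog; rewrite /=; lia.
Qed.

Lemma mdeg_cons e g p x : homog p x -> mdeg e g -> mdeg (p + 1 + e) (fun a => g (x :: a)).
Proof.
move=> xp ge q a qa; have := ge (p :: q) (x :: a); rewrite /homogs /= xp => /(_ qa).
by rewrite big_cons; congr homog; lia.
Qed.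

Lemma mdeg_insertion c t e e' m g : (forall q x, homog q x -> homog q (t x)) ->
  (forall q a, homogs q a -> homog (\sum_(p <- q) p + (size a)%:Z + e') (m a)) ->
  mdeg e g -> mdeg (e + e' + 1) (insertion c t m g).
Proof.
move=> th me ge q a; elim: a q e g ge => [|x a IHa] q e g ge qa; first exact: homog0.
have [p [q' [-> xp aq]]] := homogs_cons qa.
have -> : \sum_(p <- p :: q') p + (size (x :: a))%:Z + (e + e' + 1) =
          \sum_(p <- q') p + (size a)%:Z + (p + 1 + e + e' + 1).
  by rewrite big_cons /=; lia.
rewrite homogD ?homogZ //; last by apply: IHa => //; apply: mdeg_cons => //; exact: th.
apply: mdeg_split_sum aq => q1 q2 r s qr qs.
have xr : homogs (p :: q1) (x :: r) by apply/andP.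
have := ge (_ :: q2) (m (x :: r) :: s) (introT andP (conj (me _ _ xr) qs)).
rewrite !big_cons /=; congr homog; lia.
Qed.

End Degree.

(** * The boundary of the defect *)

Section Defect.
Variables (R : comPzRingType) (M : gradedModule R) (C : diffAlgebra R).
Variables (X : seq M -> M) (F : seq M -> C).
Local Notation d := (diff C).

Lemma dmulDl (u v w : C) : dmul (u + v) w = dmul u w + dmul v w.
Proof. exact: linD (dmul_linearl w) _ _. Qed.
Lemma dmulDr (u v w : C) : dmul u (v + w) = dmul u v + dmul u w.
Proof. exact: linD (dmul_linearr u) _ _. Qed.
Lemma dmulZl c (u v : C) : dmul (c *: u) v = c *: dmul u v.
Proof. exact: linZ (dmul_linearl v) _ _. Qed.
Lemma dmulZr c (u v : C) : dmul u (c *: v) = c *: dmul u v.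
Proof. exact: linZ (dmul_linearr u) _ _. Qed.

(** The operation m_2 of [C]. *)
Definition mu (u v : C) : C := - dmul (hat u) v.

Lemma mu_linearl v : linear (mu^~ v).
Proof. by move=> c x y; rewrite /mu linearP dmulDl dmulZl opprD scalerN. Qed.

Lemma mu_linearr u : linear (mu u).
Proof. by move=> c x y; rewrite /mu dmulDr dmulZr opprD scalerN. Qed.

Lemma mu_homog (p q : int) u v : homog p u -> homog q v -> homog (p + q) (mu u v).
Proof.
case: p q => p [] q;
  try by move=> /eqP up /eqP vq; rewrite /mu ?up ?vq ?linear0 ?dmul0l ?dmul0r oppr0 homog0.
by move=> up vq; apply/homogN/dmul_homog => //; exact: homog_hat.
Qed.

(** The part t = 2 of the composition sum. Cuts with an empty piece are harmless, since degree -1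
    forces [F [::] = 0] ([mdeg_nil]). *)
Definition cup a : C := split_sum (fun r s => mu (F r) (F s)) a.

(* The difference of the two sides of the morphism relation for F.            *)
Definition defect a : C := insertion (-1) (@hat R M) X F a - d (F a) - cup a.

Hypotheses (XL : mlin X) (FL : mlin F) (Fdeg : mdeg (-1) F) (Xdeg : mdeg (-2) X).

Lemma mlin_cup : mlin cup.
Proof.
apply: mlin_split_sum => [r|s] p s' c x y; rewrite FL.
  exact: mu_linearr.
exact: mu_linearl.
Qed.

Lemma mlin_defect : mlin defect.
Proof.
move=> p s c x y; rewrite /defect FL mlin_cup mlin_insertion //; last exact: linearP.
rewrite linearP !opprD !scalerDr !scalerN !addrA.
by rewrite -!(addrAC _ (insertion _ _ _ _ (p ++ y :: s)))
  -!(addrAC _ (- d (F (p ++ y :: s)))).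
Qed.

Lemma mdeg_defect : mdeg (-2) defect.
Proof.
move=> q a qa; rewrite homogD ?homogD ?homogN //.
- by apply: (@mdeg_insertion _ _ _ _ _ (-1) (-2)) qa => // *; exact: homog_hat.
- have := diff_homog (Fdeg qa); congr homog; lia.
- apply: mdeg_split_sum qa => q1 q2 r s qr qs.
  by have := mu_homog (Fdeg qr) (Fdeg qs); congr homog; lia.
Qed.

Lemma diff_mu u v : d (mu u v) = - (mu (d u) v + dmul u (d v)).
Proof.
by rewrite /mu linearN /= diff_dmul hatK -[d (hat u)]opprK -hat_diff dmulNl.
Qed.

(** The signs met when an insertion passes the left factor turn [mu] into the plain product; hence
    the mixed shape of the formulas below. *)
Lemma mu_hat a v : (-1) ^+ size a *: mu (F (map (@hat R M) a)) v = dmul (F a) v.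
Proof.
rewrite /mu (hat_multilinear _ FL Fdeg) size_map -map_comp (eq_map (@hatK R M)) map_id.
by rewrite dmulZl addn1 exprS mulN1r scaleNr opprK scalerA -expr2 sqrr_sign scale1r.
Qed.

Lemma insertion_cup a :
  insertion (-1) (@hat R M) X cup a =
  split_sum (fun r s => mu (insertion (-1) (@hat R M) X F r) (F s)
                        + dmul (F r) (insertion (-1) (@hat R M) X F s)) a.
Proof.
rewrite insertion_split; apply: eq_split_sum => r s _.
rewrite -(insertion_lin _ _ _ _ _ (mu_linearl (F s))); congr (_ + _).
by rewrite -(insertion_lin _ _ _ _ _ (mu_linearr _)) mu_hat.
Qed.

Lemma diff_cup a :
  d (cup a) = - split_sum (fun r s => mu (d (F r)) (F s) + dmul (F r) (d (F s))) a.
Proof.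
rewrite (split_sum_lin _ _ (linearP d)) -scaleN1r -split_sumZ.
by apply: eq_split_sum => r s _; rewrite diff_mu scaleN1r.
Qed.

(** Over cuts into three pieces, the two bracketings of the product cancel by associativity. *)
Lemma cup_cup a :
  split_sum (fun r s => mu (cup r) (F s) + dmul (F r) (cup s)) a = 0.
Proof.
rewrite split_sumD.
under eq_split_sum => r s _ do rewrite (split_sum_lin _ _ (mu_linearl (F s))).
rewrite -split_sumA -split_sumD -[RHS](split_sum0 _ a); apply: eq_split_sum => r s _.
rewrite (split_sum_lin _ _ (dmul_linearr (F r))) -split_sumD.
rewrite -[RHS](split_sum0 _ s); apply: eq_split_sum => r' s' _.
by rewrite /mu linearN /= hat_dmul hatK dmulNl opprK dmulNr dmulA subrr.
Qed.

Lemma insertion_defect a :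
  insertion (-1) (@hat R M) X F a = defect a + d (F a) + cup a.
Proof. by rewrite /defect addrAC !subrK. Qed.

(** Substitute [insertion_defect] into the double insertion. This yields the insertion of the
    defect, the boundary of the insertion of [F], and the insertion of [cup]. In the last, expanded
    by [insertion_cup], the terms with [d (F _)] are minus the boundary of [cup], and those with
    [cup] vanish by [cup_cup]. *)
Lemma diff_defect a :
  d (defect a) = insertion 1 id (insertion (-1) (@hat R M) X X) F a
    - insertion (-1) (@hat R M) X defect a
    - split_sum (fun r s => mu (defect r) (F s) + dmul (F r) (defect s)) a.
Proof.
rewrite -insertion_insertion //; first last.
- by move=> b; rewrite (hat_multilinear _ XL Xdeg) exprD /= sqrrN expr1n mulr1.
- exact: hatK.
have -> : d (defect a) = d (insertion (-1) (@hat R M) X F a) - d (cup a).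
  by rewrite !linearB /= diff_diff subr0.
move: (defect) (insertion_defect) => D DE.
have -> : insertion (-1) (@hat R M) X (insertion (-1) (@hat R M) X F) a =
   insertion (-1) (@hat R M) X (fun b => D b + d (F b) + cup b) a.
  by apply: eq_insertion => p b s _ _; exact: DE.
rewrite !insertion_add -(insertion_lin _ _ _ _ _ (linearP d)) insertion_cup.
rewrite diff_cup opprK.
have -> : split_sum (fun r s => mu (insertion (-1) (@hat R M) X F r) (F s)
                        + dmul (F r) (insertion (-1) (@hat R M) X F s)) a =
  split_sum (fun r s => mu (D r) (F s) + dmul (F r) (D s)) a
  + split_sum (fun r s => mu (d (F r)) (F s) + dmul (F r) (d (F s))) a
  + split_sum (fun r s => mu (cup r) (F s) + dmul (F r) (cup s)) a.
  rewrite -!split_sumD; apply: eq_split_sum => r s _; rewrite !DE.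
  rewrite !dmulDr !(linD (mu_linearl _)) !addrA.
  by rewrite [LHS](ACl (1*4*2*5*3*6))%AC.
rewrite cup_cup addr0 !addrA [RHS](ACl (2*4*(1*5)*(3*6)))%AC /=.
by rewrite !subrr !addr0.
Qed.

End Defect.

(** * Multilinear maps on a free graded module *)

Section FormalSum.
Variables (R : comPzRingType) (M : lmodType R).
Implicit Types l : seq (R * M).

(** The list is a formal linear combination; [k] need not be linear, so that values prescribed on
    basis vectors alone can be extended. *)
Definition formal_sum (N : lmodType R) (k : M -> N) l : N :=
  \sum_(p <- l) p.1 *: k p.2.

Definition formal_coef l b : R := \sum_(p <- l | p.2 == b) p.1.

Lemma formal_sum_coef (N : lmodType R) (k : M -> N) l :
  formal_sum k l = \sum_(b <- undup (map snd l)) formal_coef l b *: k b.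
Proof.
under [RHS]eq_bigr do rewrite scaler_suml big_mkcond.
rewrite exchange_big; apply: eq_big_seq => p pl /=.
rewrite (bigD1_seq p.2) ?undup_uniq ?mem_undup ?map_f //= eqxx big1 ?addr0 //.
by move=> b /negPf; rewrite eq_sym => ->.
Qed.

Lemma formal_sum_lin (N N' : lmodType R) (f : N -> N') (k : M -> N) l :
  linear f -> f (formal_sum k l) = formal_sum (fun b => f (k b)) l.
Proof. by move=> fL; rewrite (lin_sum fL); apply: eq_bigr => p _; rewrite (linZ fL). Qed.

Lemma formal_sum_cat (N : lmodType R) (k : M -> N) l l' :
  formal_sum k (l ++ l') = formal_sum k l + formal_sum k l'.
Proof. exact: big_cat. Qed.

Lemma formal_sum_scale (N : lmodType R) (k : M -> N) c l :
  formal_sum k [seq (c * p.1, p.2) | p <- l] = c *: formal_sum k l.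
Proof. by rewrite /formal_sum big_map scaler_sumr; apply: eq_bigr => p _; rewrite scalerA. Qed.

End FormalSum.

Section FreeGraded.
Variables (R : comPzRingType) (M : gradedModule R).
Hypothesis Mfree : forall q : nat, free_submodule (fun u : M => homog q u).

(** [e x] expands [x] in bases of the components. The condition [x != 0] is there because zero is
    homogeneous of every degree while its list need not be empty. *)
Lemma homogeneous_coordinates : exists e : M -> seq (R * M),
  [/\ forall (N : lmodType R) (k : M -> N), linear (fun x => formal_sum k (e x)),
      forall x, formal_sum id (e x) = x
    & forall (q : nat) x, x != 0 -> homog q x -> forall p, p \in e x -> homog q p.2].
Proof.
have [B BP] := choice Mfree.
have Bhomog q b : B q b -> homog q b by case: (BP q) => + _ _; apply.
pose inB (l : seq (R * M)) := forall p, p \in l -> exists q, B q p.2.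
have indep l (N : lmodType R) (k : M -> N) :
    inB l -> formal_sum id l = 0 -> formal_sum k l = 0.
  move=> lB l0; rewrite formal_sum_coef big1_seq //= => b; rewrite mem_undup.
  case/mapP=> p pl ->{b}; have [q Bp] := lB p pl; have [_ _ Bq] := BP q.
  pose s := [seq b <- undup (map snd l) | `[< B q b >]].
  rewrite (Bq s (formal_coef l)) ?scale0r ?filter_uniq ?undup_uniq //.
  - by move=> b; rewrite mem_filter => /andP[/asboolP].
  (* Projecting to degree [q] keeps exactly the part of the relation supported on [B q]. *)
  - have := congr1 (gr_proj M q) l0.
    rewrite linear0 formal_sum_coef linear_sum /= => l0q; rewrite -[RHS]l0q.
    rewrite big_filter big_mkcond. apply: eq_big_seq => b.
    rewrite mem_undup => /mapP[p' p'l ->{b}]; rewrite linearZ /=.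
    case: asboolP => [Bp'|nBp']; first by rewrite (eqP (Bhomog _ _ Bp')).
    have [q' Bq'] := lB _ p'l; rewrite (gr_proj_homog _ (Bhomog _ _ Bq')).
    by case: eqP => [qq'|]; rewrite ?scaler0 //; case: nBp'; rewrite qq'.
  by rewrite mem_filter mem_undup map_f // andbT; apply/asboolP.
have coordq q x : homog q%:Z x -> exists l : seq (R * M),
    formal_sum id l = x /\ forall p, p \in l -> B q p.2.
  have [_ span _] := BP q; move=> /span[s [c [sB ->]]].
  exists [seq (c b, b) | b <- s]; split; first by rewrite /formal_sum big_map.
  by move=> p /mapP[b /sB Bb ->].
have coord x : exists l : seq (R * M), [/\ inB l, formal_sum id l = x
    & forall q : nat, x != 0 -> homog q x -> forall p, p \in l -> homog q p.2].
  have [[q xq]|nx] := pselect (exists q : nat, homog q x).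
    have [l [lx lB]] := coordq q x xq; exists l; split=> //.
      by move=> p /lB; exists q.
    move=> q' x0 xq' p /lB/Bhomog; have [[->//]|qq'] := eqVneq q%:Z q'%:Z.
    by rewrite (homog_uniq xq xq' qq') eqxx in x0.
  have [l lP] := choice (fun q => coordq q _ (homog_proj q x)).
  have [n xE] := gr_proj_sum x; exists (flatten [seq l q | q <- iota 0 n]); split.
  - by move=> p /flatten_mapP[q _ pq]; exists q; exact: (lP q).2.
  - rewrite /formal_sum big_flatten big_map [RHS]xE
      -(big_mkord xpredT (fun q => gr_proj M q x)).
    by rewrite /index_iota subn0; apply: eq_bigr => q _; exact: (lP q).1.
  by move=> q _ xq; case: nx; exists q.
have [e eP] := choice coord; exists e; split; last 2 first.
- by move=> x; case: (eP x).
- by move=> q x; case: (eP x) => _ _; exact.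
(* The lists of [c *: x + y], of [x] scaled by [- c] and of [y] scaled by -1 form together a
   relation among basis vectors. So [indep] gives linearity, although [e] was merely chosen. *)
move=> N k c x y; apply/eqP; rewrite -subr_eq0 opprD addrA; apply/eqP.
rewrite -scaleNr -[- formal_sum k (e y)]scaleN1r -!formal_sum_scale -!formal_sum_cat.
have [exB ex _] := eP x; have [eyB ey _] := eP y; have [ezB ez _] := eP (c *: x + y).
apply: indep => [p|].
  rewrite !mem_cat => /orP[/orP[/ezB//|/mapP[p' /exB + ->]//]|/mapP[p' /eyB + ->]//].
by rewrite !formal_sum_cat !formal_sum_scale ex ey ez scaleNr scaleN1r addrAC addrK subrr.
Qed.

Variable e : M -> seq (R * M).
Hypotheses (eL : forall (N : lmodType R) (k : M -> N), linear (fun x => formal_sum k (e x)))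
  (eK : forall x, formal_sum id (e x) = x)
  (eH : forall (q : nat) x, x != 0 -> homog q x -> forall p, p \in e x -> homog q p.2).

Lemma formal_sum_homog (N : gradedModule R) (k : M -> N) (q q' : int) x :
  homog q x -> (forall b, homog q b -> homog q' (k b)) -> homog q' (formal_sum k (e x)).
Proof.
have [->|x0] := eqVneq x 0; first by move=> _ _; rewrite (lin0 (@eL N k)) homog0.
case: q => q xq kq; last by rewrite (eqP xq) eqxx in x0.
rewrite /formal_sum big_seq; apply: homog_sum => p px; apply: homogZ; apply: kq.
exact: eH px.
Qed.

Fixpoint mext (N : lmodType R) (k : seq M -> N) a : N :=
  if a is x :: a' then formal_sum (fun b => mext (fun r => k (b :: r)) a') (e x)
  else k [::].

Lemma mlin_mext (N : lmodType R) (k : seq M -> N) : mlin (mext k).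
Proof.
move=> p; elim: p k => [|y p IHp] k s c u v /=; first exact: eL.
rewrite /formal_sum scaler_sumr -big_split; apply: eq_bigr => b _ /=.
by rewrite IHp scalerDr !scalerA mulrC.
Qed.

Lemma mext_mlin (N : lmodType R) (g : seq M -> N) : mlin g -> mext g =1 g.
Proof.
move=> gL a; elim: a g gL => [//|x a IHa] g gL /=.
have -> : formal_sum (fun b => mext (fun r => g (b :: r)) a) (e x) =
          formal_sum (fun b => g (b :: a)) (e x).
  by apply: eq_bigr => p _; rewrite IHa //; exact: mlin_cons.
by rewrite -(formal_sum_lin _ _ (mlin_head a gL)) eK.
Qed.

Lemma mext_lin (N N' : lmodType R) (f : N -> N') (k : seq M -> N) a :
  linear f -> f (mext k a) = mext (fun r => f (k r)) a.
Proof.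
move=> fL; elim: a k => [//|x a IHa] k /=.
by rewrite (formal_sum_lin _ _ fL); apply: eq_bigr => p _; rewrite IHa.
Qed.

Lemma mdeg_mext (N : gradedModule R) i (k : seq M -> N) : mdeg i k -> mdeg i (mext k).
Proof.
move=> ki q a; elim: a q i k ki => [|x a IHa] q i k ki qa; first exact: ki qa.
have [p [q' [-> xp aq]]] := homogs_cons qa.
apply: (formal_sum_homog xp) => b bp.
have := IHa q' _ _ (mdeg_cons bp ki) aq; congr homog.
by rewrite big_cons /=; lia.
Qed.

(** If [z] has degree n, the component of degree n + 1 of any primitive is still a primitive; zero,
    having every degree, gets the primitive 0. *)
Lemma homog_primitive (D : diffModule R) (z : D) : (exists y, diff D y = z) ->
  exists y, diff D y = z /\ forall q, homog q z -> homog (q + 1) y.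
Proof.
move=> [y yz]; have [->|z0] := eqVneq z 0.
  by exists 0; split=> [|q _]; rewrite ?linear0 ?homog0.
have [[[n|n] zn]|nz] := pselect (exists q, homog q z); last 2 first.
- by rewrite (eqP zn) eqxx in z0.
- by exists y; split=> // q zq; case: nz; exists q.
exists (gr_proj D n.+1 y); split; first by rewrite -gr_proj_diff yz (eqP zn).
move=> q zq; have [<-|qn] := eqVneq n%:Z q; last by rewrite (homog_uniq zn zq qn) eqxx in z0.
have -> : n%:Z + 1 = n.+1%:Z by lia.
exact: homog_proj.
Qed.

End FreeGraded.

(* The primitives are only chosen, without any linearity, on tuples of basis  *)
(* elements, and then extended multilinearly.                                 *)
Lemma multilinear_primitive (R : comPzRingType) (M : gradedModule R)
    (D : diffModule R) i (g : seq M -> D) :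
  (forall q : nat, free_submodule (fun u : M => homog q u)) ->
  mlin g -> mdeg i g -> (forall a, exists y, diff D y = g a) ->
  exists h : seq M -> D, [/\ mlin h, mdeg (i + 1) h & forall a, diff D (h a) = g a].
Proof.
move=> /homogeneous_coordinates[e [eL eK eH]] gL gi gB.
have [k kP] := choice (fun a => homog_primitive (gB a)).
exists (mext e k); split; first exact: mlin_mext.
  apply: mdeg_mext => // q a qa; rewrite addrA; apply: (kP a).2; exact: gi.
move=> a; rewrite (mext_lin _ _ _ (linearP (diff D))) -[RHS](mext_mlin eK gL).
by congr mext; apply/funext => b; exact: (kP b).1.
Qed.

(** * The inductive construction *)

Section Truncation.
Variables (R : comPzRingType) (M : gradedModule R).

Definition trunc (L : lmodType R) n (g : seq M -> L) a : L :=
  if size a == n then g a else 0.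

Lemma mlin_trunc (L : lmodType R) n (g : seq M -> L) : mlin g -> mlin (trunc n g).
Proof.
move=> gL p s c x y; rewrite /trunc !size_cat /=.
by case: eqP => _; rewrite ?scaler0 ?addr0 // gL.
Qed.

Lemma mdeg_trunc (N : gradedModule R) n i (g : seq M -> N) : mdeg i g -> mdeg i (trunc n g).
Proof. by move=> gi q a qa; rewrite /trunc; case: eqP => // _; [exact: gi|exact: homog0]. Qed.

Lemma trunc_size (L : lmodType R) n (g : seq M -> L) a : size a = n -> trunc n g a = g a.
Proof. by rewrite /trunc => ->; rewrite eqxx. Qed.

Lemma trunc_neq (L : lmodType R) n (g : seq M -> L) a : size a != n -> trunc n g a = 0.
Proof. by rewrite /trunc => /negPf ->. Qed.

Lemma mlinD (L : lmodType R) (g h : seq M -> L) :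
  mlin g -> mlin h -> mlin (fun a => g a + h a).
Proof. by move=> gL hL p s c x y; rewrite gL hL scalerDr addrACA. Qed.

Lemma mlinN (L : lmodType R) (g : seq M -> L) : mlin g -> mlin (fun a => - g a).
Proof. by move=> gL p s c x y; rewrite gL opprD scalerN. Qed.

Lemma mlin_comp (L L' : lmodType R) (f : L -> L') (g : seq M -> L) :
  linear f -> mlin g -> mlin (fun a => f (g a)).
Proof. by move=> fL gL p s c x y; rewrite gL fL. Qed.

End Truncation.

Lemma mdeg_nil (R : comPzRingType) (M N : gradedModule R) n (g : seq M -> N) :
  mdeg (Negz n) g -> g [::] = 0.
Proof.
move=> gn; have := gn [::] [::] isT; rewrite big_nil !add0r => /eqP; exact.
Qed.

(** * Extending the structure by one arity *)

Section Stage.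
Variables (R : comPzRingType) (C : diffAlgebra R).
Local Notation H := (homology C).
Local Notation d := (diff C).
Local Notation ins := (@insertion _ _ (-1) (@hat _ H)).
Hypothesis Hfree : forall q : nat, free_submodule (fun u : H => homog q u).

(* Meaningful only on cycles; other elements are sent to 0. *)
Definition hclass_of (x : C) : H := hclass (insubd (0 : cycles C) x).

Lemma val_insubd_cycle x : d x = 0 -> val (insubd (0 : cycles C) x) = x.
Proof. by move=> dx; rewrite val_insubd /cycle_pred /= dx eqxx. Qed.

Lemma hclass_of_val (z : cycles C) : hclass_of (val z) = hclass z.
Proof. by congr hclass; apply: val_inj; rewrite val_insubd_cycle // diff_cycle. Qed.

Lemma hclass_ofP c x y : d x = 0 -> d y = 0 ->
  hclass_of (c *: x + y) = c *: hclass_of x + hclass_of y.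
Proof.
move=> dx dy; rewrite -(val_insubd_cycle dx) -(val_insubd_cycle dy).
by rewrite -(linearP (\val : cycles C -> C)) !hclass_of_val linearP.
Qed.

Lemma hclass_of0 : hclass_of 0 = 0.
Proof. by rewrite -[0 in LHS](linear0 (\val : cycles C -> C)) hclass_of_val linear0. Qed.

Lemma hclass_of_homog (q : int) x : d x = 0 -> homog q x -> homog q (hclass_of x).
Proof.
case: q => q dx xq; last by rewrite (eqP xq) hclass_of0 homog0.
by apply/homog_homologyP; exists (insubd 0 x); rewrite val_insubd_cycle.
Qed.

Lemma hclass_of_diff x : hclass_of (d x) = 0.
Proof.
rewrite -hclass_of0; apply/hclass_eq; exists x.
by rewrite (val_insubd_cycle (diff_diff x)) (val_insubd_cycle (linear0 d)) subr0.
Qed.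

Lemma hclass_of_eq x y : d x = 0 -> d y = 0 -> hclass_of x = hclass_of y ->
  exists w, d w = x - y.
Proof.
move=> dx dy /hclass_eq[w]; rewrite !val_insubd_cycle // => ->; by exists w.
Qed.

(** On longer words [F] and [X] may be any multilinear maps of the right degree; later steps correct
    these values. *)
Definition stage n (F : seq H -> C) (X : seq H -> H) : Prop :=
  [/\ mlin F, mlin X, mdeg (-1) F & mdeg (-2) X] /\
  [/\ forall u, d (F [:: u]) = 0 /\ hclass_of (F [:: u]) = u,
      forall u, X [:: u] = 0,
      forall a, (size a <= n)%N -> defect X F a = 0
    & forall a, (size a <= n)%N -> ins X X a = 0].

(** In [diff_defect] all terms with a defect vanish, which leaves [F [:: ins X X a]]. Its class is
    [ins X X a]; being a boundary, it has class 0. *)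
Lemma stage_diff_defect n F X a : stage n F X -> size a = n.+1 ->
  ins X X a = 0 /\ d (defect X F a) = 0.
Proof.
move=> [[FL XL Fdeg Xdeg] [F1 X1 def0 XX0]] an.
have F0 : F [::] = 0 := mdeg_nil Fdeg.
suff dE : d (defect X F a) = F [:: ins X X a].
  have XXa : ins X X a = 0.
    by rewrite -[LHS](F1 _).2 -dE hclass_of_diff.
  by split=> //; rewrite dE XXa; exact: (mlin_slot0 [::] [::] FL).
rewrite (diff_defect XL FL Fdeg Xdeg) -[RHS]subr0 -[RHS]subr0; congr (_ - _ - _).
- apply: insertion_full => //; first by rewrite an.
  by move=> p b s /andP[_ ba] _; apply: XX0; rewrite -ltnS -an.
- rewrite -[RHS](insertion0 (-1) (@hat _ H) _ X a).
  apply: eq_insertion => p b s b0 pbs.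
  (* A block of at least two letters shortens the word to arity at most [n]; a block of one letter
     meets X_1 = 0. *)
  have [b1|b1] := leqP (size b) 1; last first.
    rewrite def0 // -ltnS -an -pbs !size_cat size_map ltn_add2l.
    exact: leq_add b1 (leqnn _).
  case: b b0 b1 pbs => [|u []] // _ _ _.
  by rewrite X1 (mlin_slot0 _ _ (mlin_defect XL FL)).
rewrite -[RHS](split_sum0 _ a); apply: eq_split_sum => r s rs.
have := congr1 size rs; rewrite size_cat an => rsn.
case: s rs rsn => [|x s] rs rsn.
  rewrite F0 (def0 [::]) // dmul0r addr0; exact: (lin0 (mu_linearr _)).
rewrite (def0 r) ?(lin0 (mu_linearl _)) ?add0r; last first.
  by move: rsn; rewrite addnS => -[<-]; exact: leq_addr.
case: r rs rsn => [|y r] rs rsn; first by rewrite F0 dmul0l.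
by rewrite (def0 (x :: s)) ?dmul0r //; move: rsn; rewrite addSn => -[<-]; exact: leq_addl.
Qed.

(** Inserted blocks are nonempty, so no word longer than [a] is ever evaluated. *)
Lemma stage_local n (F F' : seq H -> C) (X X' : seq H -> H) a :
  (forall b, (size b <= n)%N -> F' b = F b) -> (forall b, (size b <= n)%N -> X' b = X b) ->
  (size a <= n)%N -> defect X' F' a = defect X F a /\ ins X' X' a = ins X X a.
Proof.
move=> FF XX an.
have sub (L : lmodType R) (g g' : seq H -> L) :
    (forall b, (size b <= n)%N -> g' b = g b) -> ins X' g' a = ins X g a.
  move=> gg; apply: eq_insertion => p b s b0 pbs.
  have bn : (size p + (size b + size s) <= n)%N by rewrite -!size_cat pbs.
  rewrite XX; last by apply: leq_trans bn; rewrite addnCA leq_addr.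
  rewrite gg // size_cat size_map; apply: leq_trans bn.
  rewrite leq_add2l; exact: leq_add b0 (leqnn _).
split; last exact: sub.
rewrite /defect (sub _ _ _ FF) FF //; congr (_ - _ - _).
apply: eq_split_sum => r s rs.
have rsn : (size r + size s <= n)%N by rewrite -size_cat rs.
by rewrite !FF //; apply: leq_trans rsn; rewrite ?leq_addr ?leq_addl.
Qed.

Lemma stage_succ n F X : (0 < n)%N -> stage n F X -> exists F' X',
  stage n.+1 F' X' /\ forall a, (size a <= n)%N -> F' a = F a /\ X' a = X a.
Proof.
move=> n0 st; have defP a := stage_diff_defect (a := a) st.
have [[FL XL Fdeg Xdeg] [F1 X1 def0 XX0]] := st.
have F0 : F [::] = 0 := mdeg_nil Fdeg.
pose G := trunc n.+1 (defect X F).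
have GL : mlin G := mlin_trunc _ (mlin_defect XL FL).
have Gdeg : mdeg (-2) G := mdeg_trunc _ (mdeg_defect Fdeg Xdeg).
have dG a : d (G a) = 0.
  by rewrite /G /trunc; case: eqP => [/defP[]|]; rewrite ?linear0.
pose Y a := hclass_of (G a).
have YL : mlin Y by move=> p s c x y; rewrite /Y GL hclass_ofP.
have Ydeg : mdeg (-2) Y by move=> q a qa; apply: hclass_of_homog; [exact: dG|exact: Gdeg].
have Y0 a : size a != n.+1 -> Y a = 0 by move=> an; rewrite /Y /G trunc_neq // hclass_of0.
have F1L : linear (fun u => F [:: u]) := mlin_head [::] FL.
have [//||||h [hL hdeg dh]] := @multilinear_primitive _ _ C (-2) (fun a => G a - F [:: Y a]).
- by apply: mlinD => //; apply: mlinN; exact: (mlin_comp F1L).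
- move=> q a qa; apply: homogD; first exact: Gdeg.
  apply: homogN; have := Fdeg [:: _] [:: Y a] (introT andP (conj (Ydeg q a qa) isT)).
  by rewrite big_seq1 addrK; congr homog.
(* Both cycles have class [Y a], so their difference bounds. *)
- move=> a; apply: hclass_of_eq; [exact: dG|exact: (F1 _).1|by rewrite (F1 _).2].
pose K := trunc n.+1 h.
have KL : mlin K := mlin_trunc _ hL.
have Kdeg : mdeg (-1) K := mdeg_trunc _ hdeg.
pose F' a := F a + K a; pose X' a := X a - Y a.
have FF a : (size a <= n)%N -> F' a = F a.
  by move=> an; rewrite /F' /K trunc_neq ?addr0 // neq_ltn ltnS an.
have XX a : (size a <= n)%N -> X' a = X a.
  by move=> an; rewrite /X' Y0 ?subr0 // neq_ltn ltnS an.
have X'1 u : X' [:: u] = 0 by rewrite XX.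
exists F', X'; split; last by move=> a an; rewrite FF ?XX.
split; first split.
- exact: mlinD.
- by apply: mlinD => //; exact: mlinN.
- by move=> q a qa; rewrite homogD ?Fdeg ?Kdeg.
- by move=> q a qa; rewrite homogD ?homogN ?Xdeg ?Ydeg.
split=> //; first by move=> u; rewrite FF.
- move=> a; rewrite leq_eqVlt => /orP[/eqP an|]; last first.
    by rewrite ltnS => an; rewrite (stage_local FF XX an).1 def0.
  have cupE : cup F' a = cup F a.
    apply: eq_split_sum => r s rs.
    have rsn : (size r + size s)%N = n.+1 by rewrite -size_cat rs.
    have F'0 : F' [::] = 0 by rewrite FF.
    case: r s rs rsn => [|x r] [|y s] rs rsn //.
    - by rewrite F0 F'0 !(lin0 (mu_linearl _)).
    - by rewrite F0 F'0 !(lin0 (mu_linearr _)).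
    have xn : (size (x :: r) <= n)%N by move: rsn; rewrite addnS => -[<-]; exact: leq_addr.
    have yn : (size (y :: s) <= n)%N by move: rsn; rewrite addSn => -[<-]; exact: leq_addl.
    by rewrite !FF.
  have insE : ins X' F' a = ins X F a - F [:: Y a].
    rewrite insertion_add.
    (* [K] lives in arity [n.+1], and an insertion preserves the length only for one-letter blocks,
       on which [X'] vanishes. *)
    have -> : ins X' K a = 0.
      rewrite -[RHS](insertion0 (-1) (@hat _ H) _ X' a); apply: eq_insertion => p b s b0 pbs.
      have [b1|b1] := eqVneq (size b) 1%N.
        by case: b b1 {b0 pbs} => [|u []] // _; rewrite X'1 (mlin_slot0 _ _ KL).
      rewrite /K trunc_neq //; apply: contra b1 => /eqP.
      rewrite -an -pbs !size_cat size_map => /addnI bs.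
      by rewrite -(eqn_add2r (size s)) -bs.
    rewrite addr0 (insertion_addm _ _ _ _ _ FL); congr (_ + _).
    rewrite (insertion_full _ _ FL) ?an //; first exact: (linN F1L).
    move=> p b s /andP[_ bn] _; rewrite Y0 ?oppr0 //; by rewrite neq_ltn bn.
  rewrite /defect insE cupE /F' linearD /=.
  have -> : d (K a) = defect X F a - F [:: Y a] by rewrite /K trunc_size // dh /G trunc_size.
  rewrite /defect; move: (ins X F a) (F [:: Y a]) (d (F a)) (cup F a) => A B D E.
  by rewrite !opprD !opprK !addrA [LHS](ACl ((1*4)*(2*7)*(3*5)*(6*8)))%AC /= !subrr !addNr !addr0.
(* In the relation of arity [n.+1], X_{n+1} occurs only composed with X_1 = 0, so changing it is
   harmless. *)
move=> a; rewrite leq_eqVlt => /orP[/eqP an|]; last first.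
  by rewrite ltnS => an; rewrite (stage_local FF XX an).2 XX0.
rewrite -(defP a an).1; apply: eq_insertion => p b s b0 pbs.
have [b1|b1] := leqP (size b) 1.
  case: b b1 b0 {pbs} => [|u []] // _ _; rewrite X'1 X1.
  rewrite (mlin_slot0 _ _ XL) (mlin_slot0 (g := X')) //.
  by apply: mlinD => //; exact: mlinN.
have [bn|bn] := leqP (size b) n.
  rewrite (XX b bn) XX // -ltnS -an -pbs !size_cat size_map ltn_add2l.
  exact: leq_add b1 (leqnn _).
have /eqP : (size p + size s)%N = 0%N.
  apply/eqP; rewrite -leqn0 -(leq_add2l (size b)) addn0 addnCA -!size_cat pbs an.
  exact: bn.
by rewrite addn_eq0 => /andP[/nilP-> /nilP->]; rewrite X'1 X1.
Qed.

End Stage.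

(** * The first stage and the limit *)

Lemma homogeneous_representative (R : comPzRingType) (D : diffModule R) (u : homology D) :
  exists z : cycles D, hclass z = u /\ forall q : int, homog q u -> homog q (val z).
Proof.
have [->|u0] := eqVneq u 0.
  by exists 0; split=> [|q _]; rewrite ?linear0 ?homog0.
have [[q uq]|nu] := pselect (exists q : nat, homog q u); last first.
  have [z uz] := hclassP u; exists z; split=> // -[] q uq; first by case: nu; exists q.
  by rewrite (eqP uq) eqxx in u0.
have [z [zq uz]] := (homog_homologyP q u).1 uq; exists z; split=> // q' uq'.
have [<-//|qq'] := eqVneq q%:Z q'.
by rewrite (homog_uniq uq uq' qq') eqxx in u0.
Qed.

Section Construction.
Variables (R : comPzRingType) (C : diffAlgebra R).
Local Notation H := (homology C).
Local Notation d := (diff C).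
Hypothesis Hfree : forall q : nat, free_submodule (fun u : H => homog q u).

(** f_1 extends linearly a choice of homogeneous representatives of basis classes; everything else
    is 0. In arity 1 the morphism relation only asks for values in cycles. *)
Lemma stage_1 : exists F X, @stage R C 1 F X.
Proof.
have [e [eL eK eH]] := homogeneous_coordinates Hfree.
have [k kP] := choice (@homogeneous_representative _ C).
pose phi u : C := val (formal_sum k (e u)).
have phiL : linear phi by move=> c x y; rewrite /phi eL linearP.
pose F (a : seq H) : C := if a is [:: u] then phi u else 0.
have FL : mlin F.
  by move=> [|x [|y p]] [|z s] c v w; rewrite /F /= ?scaler0 ?addr0 //; exact: phiL.
have Fdeg : mdeg (-1) F.
  move=> [|q [|q' l]] [|v [|w a]] //; rewrite /homogs /= ?andbF // => vq;
    rewrite ?homog0 //.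
  move: vq; rewrite andbT => vq.
  rewrite big_seq1 addrK /F /phi (formal_sum_lin _ _ (linearP (\val : cycles C -> C))).
  by apply: (formal_sum_homog eL eH vq) => b bq; exact: (kP b).2.
exists F, (fun=> 0); split.
  by split=> // [p s c x y|q a _]; rewrite ?homog0 // scaler0 addr0.
have ins0 (L : lmodType R) (g : seq H -> L) a :
    mlin g -> insertion (-1) (@hat _ H) (fun=> 0) g a = 0.
  move=> gL; rewrite -[RHS](insertion0 (-1) (@hat _ H) _ (fun=> 0) a).
  by apply: eq_insertion => p b s _ _; rewrite (mlin_slot0 _ _ gL).
split=> // [u|a|a _].
- rewrite /= /phi diff_cycle hclass_of_val.
  rewrite (formal_sum_lin _ _ (linearP (@hclass _ C))); split=> //.
  by rewrite -[RHS]eK; apply: eq_bigr => p _; rewrite /= (kP _).1.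
- rewrite /defect ins0 //.
  have c0 x : mu 0 x = 0 :> C := lin0 (mu_linearl x).
  have c0' x : mu x 0 = 0 :> C := lin0 (mu_linearr x).
  case: a => [|u [|v a]] // _;
    rewrite /cup ?split_sum_cons ?split_sum_nil /= c0 ?c0' ?linear0 ?diff_cycle.
    by rewrite !addr0.
  by rewrite addr0 !subr0.
by rewrite ins0 // => p s c x y; rewrite scaler0 addr0.
Qed.

Lemma stage_limit : exists F X, forall n, @stage R C n F X.
Proof.
have [F1 [X1 st1]] := stage_1.
pose T := (nat * ((seq H -> C) * (seq H -> H)))%type.
(* The implication makes [next] solvable from every state, as [choice] requires. *)
pose next (x y : T) := y.1 = x.1.+1 /\
  (stage x.1.+1 x.2.1 x.2.2 -> stage y.1.+1 y.2.1 y.2.2 /\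
   forall a, (size a <= x.1.+1)%N -> y.2.1 a = x.2.1 a /\ y.2.2 a = x.2.2 a).
have nextP x : exists y, next x y.
  have [st|nst] := pselect (stage x.1.+1 x.2.1 x.2.2); last by exists (x.1.+1, x.2).
  have [F' [X' [st' eqFX]]] := stage_succ Hfree (ltn0Sn _) st.
  by exists (x.1.+1, (F', X')).
have [s nexts] := choice nextP.
pose S n := iter n s (0%N, (F1, X1)).
have S1 n : (S n).1 = n by elim: n => //= n IHn; rewrite (nexts _).1 IHn.
have Sst n : stage n.+1 (S n).2.1 (S n).2.2.
  elim: n => // n IHn; have := (nexts (S n)).2; rewrite (nexts _).1 S1.
  by case/(_ IHn).
have Seq n p a : (size a <= n.+1)%N -> (S (p + n)%N).2.1 a = (S n).2.1 a /\
    (S (p + n)%N).2.2 a = (S n).2.2 a.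
  move=> an; elim: p => // p IHp; rewrite addSn -IHp.1 -IHp.2.
  have := (nexts (S (p + n)%N)).2; rewrite S1 => /(_ (Sst _))[_]; apply.
  by rewrite (leq_trans an) // ltnS leq_addl.
(* By step [size a] the values on words of this size have stabilised ([Seq]). *)
pose F a := (S (size a)).2.1 a; pose X a := (S (size a)).2.2 a.
have FXE n a : (size a <= n)%N -> F a = (S n).2.1 a /\ X a = (S n).2.2 a.
  by move=> an; rewrite /F /X -(subnK an) !(Seq _ _ _ (leqnSn _)).1 !(Seq _ _ _ (leqnSn _)).2.
exists F, X => n; split; first split.
- move=> p s' c x y; have [[FL _ _ _] _] := Sst (size (p ++ x :: s')).
  have sz z : size (p ++ z :: s') = size (p ++ x :: s') by rewrite !size_cat.
  by rewrite /F !sz; exact: FL.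
- move=> p s' c x y; have [[_ XL _ _] _] := Sst (size (p ++ x :: s')).
  have sz z : size (p ++ z :: s') = size (p ++ x :: s') by rewrite !size_cat.
  by rewrite /X !sz; exact: XL.
- by move=> q a qa; have [[_ _ Fdeg _] _] := Sst (size a); exact: Fdeg.
- by move=> q a qa; have [[_ _ _ Xdeg] _] := Sst (size a); exact: Xdeg.
have loc a : defect X F a = 0 /\ insertion (-1) (@hat _ H) X X a = 0.
  have [_ [_ _ def0 XX0]] := Sst (size a).
  have [-> ->] := stage_local (fun b h => (FXE _ b h).1)
    (fun b h => (FXE _ b h).2) (leqnn (size a)).
  by rewrite def0 ?XX0.
split=> [u|u|a _|a _]; last 2 first; try exact: (loc a).1; try exact: (loc a).2.
- by have [_ [F1P _ _ _]] := Sst 1%N; exact: F1P.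
- by have [_ [_ X1P _ _]] := Sst 1%N; exact: X1P.
Qed.

End Construction.

(** * Comparison with the indexed sums *)

Lemma insertion_sumE (R : comPzRingType) (M N : gradedModule R) m (g : seq M -> N) a :
  insertion_sum (fun=> g) (fun=> m) (size a) a = insertion (-1) (@hat R M) m g a.
Proof.
rewrite /insertion_sum; elim: a g => [|x a IHa] g; first by rewrite big_geq.
rewrite /= big_nat_recl // expr0 -IHa; congr (_ + _).
  rewrite subn0 big_add1 /= big_mkord; apply: eq_bigr => j _.
  by rewrite scale1r.
rewrite scaleN1r -sumrN; apply: eq_bigr => k _.
rewrite -sumrN; apply: eq_bigr => j _.
by rewrite exprS mulN1r scaleNr.
Qed.

(** [C] has no operations beyond arity 2. The pairs for t = 2 are the cuts into nonempty pieces; [F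
    [::] = 0] removes the other cuts from [cup]. *)
Lemma composition_sumE (R : comPzRingType) (M : gradedModule R) (C : diffAlgebra R)
    (F : seq M -> C) a : F [::] = 0 -> (0 < size a)%N ->
  composition_sum (dga_operations C) (fun=> F) (size a) a = diff C (F a) + cup F a.
Proof.
move=> F0 a0; rewrite /composition_sum; set n := size a.
have mu0l v : mu 0 v = 0 :> C := lin0 (mu_linearl v).
have mu0r u : mu u 0 = 0 :> C := lin0 (mu_linearr u).
rewrite big_ltn // ; congr (_ + _).
  rewrite (big_pred1 [tuple (ord_max : 'I_n.+1)]) /= => [|k].
    by rewrite take_size.
  case/tupleP: k => j k; rewrite (tuple0 k) /= big_cons big_nil addn0 andbT.
  apply/andP/eqP => [[_ /eqP jn]|[->]]; last by rewrite /=.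
  by congr [tuple of _ :: _]; apply: val_inj.
have [n1|n2] := leqP n 1.
  rewrite big_geq //; rewrite {}/n in n1 *; case: a a0 n1 => [|x [|y a]] // _ _.
  by rewrite /cup split_sum_cons split_sum_nil F0 mu0l mu0r addr0.
rewrite big_ltn // [X in _ + X]big1_seq ?addr0; last first.
  move=> t /andP[_]; rewrite mem_index_iota => /andP[t2 _]; apply: big1 => k _.
  by case: t t2 k => [|[|[|t]]].
(* A pair of sum [n] is determined by its first entry, since [rev_ord j] is [n - j]. *)
pose h (j : 'I_n.+1) : 2.-tuple 'I_n.+1 := [tuple j; rev_ord j].
rewrite (reindex_onto h (fun k => tnth k ord0)); last first.
  move=> k; case/tupleP: k => j k; case/tupleP: k => j' k; rewrite (tuple0 k) /=.
  rewrite !big_cons big_nil addn0 => /andP[_ /eqP jn]; apply: val_inj; rewrite /= tnth0.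
  congr [:: _; _]; apply: val_inj; rewrite /= subSS.
  by have /= <- := congr1 (subn^~ (j : nat)) jn; rewrite addKn.
rewrite big_mkcond; apply: eq_bigr => j _.
rewrite /= !big_cons big_nil addn0 andbT subSS (subnKC (leq_ord j)) eqxx andbT tnth0 eqxx andbT.
rewrite [take (n - j) _]take_oversize; last by rewrite size_drop.
rewrite subn_gt0; case: ifP => // /negbT; rewrite negb_and -!leqNgt leqn0.
case/orP=> [/eqP->|nj]; first by rewrite take0 F0 mu0l.
by rewrite drop_oversize // F0 mu0r.
Qed.

Theorem theorem1 (Lambda : comPzRingType) (C : diffAlgebra Lambda)
    (Hfree : forall q : nat,
      free_submodule (fun u : homology C => homog q u)) :
  exists (X : nat -> seq (homology C) -> homology C)
         (f : nat -> seq (homology C) -> C),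
    [/\ Ainfty_algebra X,
        forall a, X 1%N [:: a] = 0,
        forall a1 a2, X 2%N [:: a1; a2] = - hmul (hat a1) a2,
        Ainfty_morphism X (dga_operations C) f
      & induces_identity (fun u => f 1%N [:: u])].
Proof.
have [F [X st]] := stage_limit Hfree; exists (fun=> X), (fun=> F).
have [[FL XL Fdeg Xdeg] [F1 X1 _ _]] := st 0%N.
have def0 a : defect X F a = 0 by have [_ [_ _ def0 _]] := st (size a); exact: def0.
have XX0 a : insertion (-1) (@hat _ _) X X a = 0.
  by have [_ [_ _ _ XX0]] := st (size a); exact: XX0.
have F0 : F [::] = 0 := mdeg_nil Fdeg.
have deg (N : gradedModule Lambda) (g : seq (homology C) -> N) i j :
    mdeg j g -> has_degree i (i%:Z + j) g.
  move=> gj q a <- qa; have := gj (map Posz q) a.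
  have -> : \sum_(p <- map Posz q) p = (sumn q)%:Z.
    by rewrite big_map sumnE raddf_sum.
  rewrite -addrA; apply; rewrite /homogs.
  by elim: q a qa => [|p q IHq] [|x a] //= /andP[-> /IHq].
split=> //.
- move=> i i0; split=> [s1 s2 c x y _||a <-]; [exact: XL|exact: deg|].
  by rewrite insertion_sumE XX0.
(* In arity 2 the relation says that f_1(X_2(u, v)) is a boundary minus the product of f_1(hat u)
   and f_1(v); taking classes gives X_2. *)
- move=> u v; have := def0 [:: u; v].
  have insE : insertion (-1) (@hat _ _) X F [:: u; v] = F [:: X [:: u; v]].
    by apply: insertion_full => // p [|w [|w' b]] s //= _ _; rewrite X1.
  have cupE : cup F [:: u; v] = - dmul (F [:: hat u]) (F [:: v]).
    rewrite /cup !split_sum_cons split_sum_nil /= F0 (lin0 (mu_linearl _)).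
    rewrite (lin0 (mu_linearr _)) addr0 add0r /mu (hat_multilinear _ FL Fdeg).
    by rewrite /= -signr_odd scale1r.
  have [z [zu zE]] : exists z : cycles C, F [:: hat u] = val z /\ hat u = hclass z.
    exists (insubd 0 (F [:: hat u])); have [du uE] := F1 (hat u).
    by rewrite val_insubd_cycle.
  have [z' [zv zE']] : exists z : cycles C, F [:: v] = val z /\ v = hclass z.
    exists (insubd 0 (F [:: v])); have [dv vE] := F1 v.
    by rewrite val_insubd_cycle.
  rewrite /defect insE cupE zu zv => /eqP; rewrite -addrA -opprD subr_eq0 => /eqP FX.
  rewrite zE [in RHS]zE' hmul_class -[LHS](F1 _).2 FX -[diff C _]scale1r.
  have -> : - dmul (val z) (val z') = val (- cycle_mul z z') by rewrite linearN.
  rewrite hclass_ofP ?diff_diff ?diff_cycle // hclass_of_diff scaler0 add0r.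
  by rewrite hclass_of_val linearN.
- move=> i i0; split=> [s1 s2 c x y _||a ai]; [exact: FL|exact: deg|].
  rewrite -ai insertion_sumE composition_sumE ?ai //.
  by rewrite insertion_defect def0 add0r.
- by move=> u; exists (insubd 0 (F [:: u])); have [dF uF] := F1 u; rewrite val_insubd_cycle.
Qed.
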